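(* Let $\Omega\subset\mathbb{R}^d$ be a bounded domain and let $V\in L^\infty(\Omega)$ be real-valued. Let $(\lambda_j)_{j\in\mathbb{N}^*}$ be the eigenvalues (repeated with multiplicity) and $(\phi_j)_{j\in\mathbb{N}^*}$ a corresponding orthonormal basis of $L^2(\Omega)$ of eigenfunctions of $-\Delta+V$ on $\Omega$ with Dirichlet boundary conditions. Then for every measurable subset $\omega$ of $\Omega$, $$C_\infty^V(\chi_\omega)=\inf\left\{\frac{\displaystyle\int_\omega\sum_{\lambda\in U}\Big|\sum_{k\in I(\lambda)}c_k\phi_k(x)\Big|^2dx}{\displaystyle\sum_{k=1}^\infty|c_k|^2}\ :\ (c_j)_{j\in\mathbb{N}^*}\in\ell^2(\mathbb{C})\setminus\{0\}\right\},$$ where $U$ is the set of all distinct eigenvalues $\lambda_k$ and $I(\lambda)=\{j\in\mathbb{N}^*:\lambda_j=\lambda\}$.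
   Context: $\mathbb{N}^*=\{1,2,3,\dots\}$. Consider the Schrödinger equation $i\partial_t u=\Delta u-V(x)u$ on $\mathbb{R}\times\Omega$, with $u(0,x)=u_0(x)$ and $u(t,x)=0$ for $x\in\partial\Omega$, where $u_0\in H_0^1(\Omega)\cap H^2(\Omega)$. Its solution is $u(t,x)=\sum_{j\ge1}c_je^{i\lambda_jt}\phi_j(x)$ with $c_j=\int_\Omega u_0\overline{\phi_j}\,dx$, and $\|\partial_tu(0,\cdot)\|_{L^2(\Omega)}^2=\sum_j\lambda_j^2|c_j|^2$. The time asymptotic observability constant is $$C_\infty^V(\chi_\omega)=\inf\left\{\lim_{T\to\infty}\frac1T\,\frac{\int_0^T\int_\omega|\partial_tu(t,x)|^2\,dx\,dt}{\|\partial_tu(0,\cdot)\|_{L^2(\Omega)}^2}\ :\ u(0,\cdot)\in H_0^1(\Omega)\cap H^2(\Omega)\right\},$$ where the infimum is over initial data for which the quotient is defined (i.e. $\partial_tu(0,\cdot)\neq0$).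
   Formalization: It is assumed that 0 is not an eigenvalue of −Δ+V (otherwise the equality fails, e.g. Ω=(0,π), V=−1, ω=(0,1/2)), and the eigenfunctions are taken in H¹₀(Ω)∩H²(Ω), the space of initial data, as the domain of the operator. *)

(* Defs.v *)
From HB Require Import structures.
From mathcomp Require Import all_boot all_order all_algebra.
From mathcomp Require Import all_classical all_reals all_analysis.
From mathcomp Require Import complex.

Set Implicit Arguments.
Unset Strict Implicit.
Unset Printing Implicit Defensive.

Import Order.TTheory GRing.Theory Num.Theory.
Import numFieldNormedType.Exports.

Local Open Scope classical_set_scope.
Local Open Scope ring_scope.
Local Open Scope complex_scope.

(* The space R^n, n >= 1, is 'rV[R]_d.+1. MathComp-Analysis has Lebesgue
   measure only on R, so it is built here as usual: the outer measure given by
   countable covers with half-open boxes, restricted to its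
   Caratheodory-measurable sets, i.e. to the Lebesgue-measurable sets. *)
Section lebesgue_measure_Rn.
Variables (R : realType) (d : nat).
Local Notation E := 'rV[R]_d.+1.

Definition box (p : E * E) : set E :=
  [set x | forall i, p.1 0 i < x 0 i <= p.2 0 i].

Definition box_volume (p : E * E) : \bar R :=
  (\prod_(i < d.+1) Num.max 0 (p.2 0 i - p.1 0 i))%:E.

Definition box_cover (A : set E) : set ((E * E)^nat) :=
  [set F | A `<=` \bigcup_k box (F k)].

Definition lebesgue_outer (A : set E) : \bar R :=
  ereal_inf [set (\sum_(0 <= k <oo) box_volume (F k))%E | F in box_cover A].

Lemma box_volume_ge0 p : (0 <= box_volume p)%E.
Proof. by rewrite lee_fin; apply: prodr_ge0 => i _; rewrite le_max lexx. Qed.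

Lemma lebesgue_outer_ge0 A : (0 <= lebesgue_outer A)%E.
Proof.
apply: le_ereal_inf_tmp => _ [F _ <-].
by apply: nneseries_ge0 => n _ _; exact: box_volume_ge0.
Qed.

Lemma lebesgue_outer0 : lebesgue_outer set0 = 0%E.
Proof.
apply/eqP; rewrite eq_le lebesgue_outer_ge0 andbT.
apply: ereal_inf_lbound; exists (fun=> (0, 0)) => //.
apply: eseries0 => n _ _.
by rewrite /box_volume big_ord_recl /= subrr maxxx mul0r.
Qed.

Lemma le_lebesgue_outer :
  {homo lebesgue_outer : A B / A `<=` B >-> (A <= B)%E}.
Proof.
move=> A B AB; apply: le_ereal_inf_tmp => _ [F BF <-].
by apply: ereal_inf_lbound; exists F => //; exact: subset_trans BF.
Qed.

Lemma lebesgue_outer_sigma_subadditive : sigma_subadditive lebesgue_outer.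
Proof.
move=> A; have [[i ioo]|] := pselect (exists i, lebesgue_outer (A i) = +oo%E).
  rewrite (eseries_pinfty _ _ ioo) ?leey// => n _.
  by rewrite -ltNye (lt_le_trans _ (lebesgue_outer_ge0 _)).
rewrite -forallNE => Aoo.
suff add2e (e : {posnum R}) : (lebesgue_outer (\bigcup_n A n) <=
    \sum_(0 <= i <oo) lebesgue_outer (A i) + e%:num%:E)%E.
  by apply/lee_addgt0Pr => _/posnumP[].
rewrite (le_trans _ (epsilon_trick _ _ _))//; last first.
  by move=> n; exact: lebesgue_outer_ge0.
pose P n (F : (E * E)^nat) := box_cover (A n) F /\
  (\sum_(0 <= k <oo) box_volume (F k) <=
   lebesgue_outer (A n) + (e%:num / (2 ^ n.+1)%:R)%:E)%E.
have [G PG] : {G : ((E * E)^nat)^nat & forall n, P n (G n)}.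
  apply: (@choice _ _ P) => n.
  have Afin : lebesgue_outer (A n) \is a fin_num.
    by rewrite ge0_fin_numE ?lebesgue_outer_ge0// ltey; apply/eqP/Aoo.
  have en1 : 0 < e%:num / (2 ^ n.+1)%:R :> R by [].
  have [_ [F AF <-] lt] := lb_ereal_inf_adherent en1 Afin.
  by exists F; split => //; exact/ltW.
have G_ge0 x : (0 <= (box_volume \o uncurry G) x)%E by exact: box_volume_ge0.
apply: (@le_trans _ _ (\esum_(i in setT) (box_volume \o uncurry G) i)%E).
  apply: ereal_inf_lbound => /=.
  have /card_esym/ppcard_eqP[f] := card_nat2.
  exists (uncurry G \o f).
    move=> t [i _] /(PG i).1[j _ Gt].
    have fK : f (f^-1%FUN (i, j)) = (i, j) by rewrite invK ?inE.
    by exists (f^-1%FUN (i, j)) => //; rewrite /comp fK.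
  rewrite -(esum_pred_image (box_volume \o uncurry G) _ xpredT)
    ?[fun=> _]set_true//.
  by rewrite image_eq.
rewrite (_ : esum _ _ =
    (\sum_(0 <= i <oo) \sum_(0 <= j <oo) box_volume (G i j))%E); last first.
  pose J : nat -> set (nat * nat) := fun i => [set (i, j) | j in setT].
  rewrite (_ : setT = \bigcup_k J k); last first.
    by rewrite predeqE => -[a b]; split => // _; exists a => //; exists b.
  rewrite esum_bigcupT /=; last 2 first.
    - apply/trivIsetP => i j _ _ ij.
      rewrite predeqE => -[n m] /=; split => //= -[] [_] _ [<-{n} _].
      by move=> [m' _] [] /esym/eqP; rewrite (negbTE ij).
    - by move=> /= [n m]; exact: box_volume_ge0.
  rewrite -(image_id [set: nat]) -fun_true esum_pred_image//; last first.
    by move=> n _; apply: esum_ge0 => x _; exact: box_volume_ge0.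
  apply: eq_eseriesr => /= j _.
  have Gj_ge0 n : (0 <= box_volume (G j n))%E by exact: box_volume_ge0.
  rewrite -(esum_pred_image (box_volume \o uncurry G) (pair j) predT)//=; last first.
    by move=> ? ? _ _; exact: (@can_inj _ _ _ snd).
  by congr esum; rewrite predeqE => -[a b]; split; move=> [i _ <-]; exists i.
apply: lee_lim.
- apply: is_cvg_nneseries => n _ _.
  by apply: nneseries_ge0 => m _ _; exact: (G_ge0 (n, m)).
- by apply: is_cvg_nneseries => n _ _; apply: adde_ge0 => //;
    exact: lebesgue_outer_ge0.
- by near=> n; apply: lee_sum => i _; exact: (PG i).2.
Unshelve. all: by end_near. Qed.

HB.instance Definition _ := isOuterMeasure.Build R E lebesgue_outer
  lebesgue_outer0 lebesgue_outer_ge0 le_lebesgue_outer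
  lebesgue_outer_sigma_subadditive.

Definition lebesgue_space := caratheodory_type lebesgue_outer.

HB.instance Definition _ := Measurable.on lebesgue_space.

Definition lebesgue_Rn (A : set lebesgue_space) : \bar R := lebesgue_outer A.

HB.instance Definition _ := isMeasure.Build _ lebesgue_space R lebesgue_Rn
  (@caratheodory_measure0 R E lebesgue_outer)
  (@caratheodory_measure_ge0 R E lebesgue_outer)
  (@caratheodory_measure_sigma_additive R E lebesgue_outer).

End lebesgue_measure_Rn.

Definition sqnorm (R : realType) (z : R[i]) : R :=
  complex.Re z ^+ 2 + complex.Im z ^+ 2.

Section function_spaces.
Variables (R : realType) (d : nat).
Local Notation E := 'rV[R]_d.+1.
Local Notation mu := (@lebesgue_Rn R d).
Implicit Types (Omega K : set E) (V : E -> R) (u f phi psi : E -> R[i]).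

(* A function on Omega is represented by a total function on R^n whose values
   outside Omega are irrelevant. *)

Definition cintegral (A : set E) f : R[i] :=
  (\int[mu]_(x in A) complex.Re (f x)) +i* (\int[mu]_(x in A) complex.Im (f x)).

Definition sqL2norm (A : set E) f : \bar R :=
  (\int[mu]_(x in A) (sqnorm (f x))%:E)%E.

Definition L2 (A : set E) f : Prop :=
  [/\ measurable_fun (A : set (lebesgue_space R d))
        (fun x : lebesgue_space R d => complex.Re (f x)),
      measurable_fun (A : set (lebesgue_space R d))
        (fun x : lebesgue_space R d => complex.Im (f x)) &
      (sqL2norm A f < +oo)%E].

Definition L2inner (A : set E) f (g : E -> R[i]) : R[i] :=
  cintegral A (fun x => f x * conjc (g x)).

Definition Linfty (A : set E) V : Prop :=
  measurable_fun (A : set (lebesgue_space R d)) (V : lebesgue_space R d -> R) /\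
  exists M : R, {ae mu, forall x, A x -> `|V x| <= M}.

Definition partial (i : 'I_d.+1) (h : E -> R) : E -> R :=
  fun x => 'D_(delta_mx 0 i) h x.

Definition smooth (h : E -> R) : Prop :=
  forall s : seq 'I_d.+1, let hs := foldr partial h s in
    continuous hs /\ forall i x, derivable hs x (delta_mx 0 i).

(* C_c^oo(Omega), extended by zero to the whole space. *)
Definition test_function Omega psi : Prop :=
  [/\ smooth (fun x => complex.Re (psi x)),
      smooth (fun x => complex.Im (psi x)) &
      exists2 K, compact K /\ K `<=` Omega & forall x, ~ K x -> psi x = 0].

Definition cpartial (i : 'I_d.+1) psi : E -> R[i] := fun x =>
  partial i (fun y => complex.Re (psi y)) x +i*
  partial i (fun y => complex.Im (psi y)) x.

Definition laplacian psi : E -> R[i] :=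
  fun x => \sum_(i < d.+1) cpartial i (cpartial i psi) x.

Definition weak_gradient Omega u (g : 'I_d.+1 -> E -> R[i]) : Prop :=
  forall i, L2 Omega (g i) /\
    forall psi, test_function Omega psi ->
      cintegral Omega (fun x => u x * cpartial i psi x) =
      - cintegral Omega (fun x => g i x * psi x).

Definition H1 Omega u : Prop :=
  L2 Omega u /\ exists g, weak_gradient Omega u g.

Definition H2 Omega u : Prop :=
  L2 Omega u /\
  exists2 g, weak_gradient Omega u g & forall i, H1 Omega (g i).

(* H^1_0(Omega): the closure of C_c^oo(Omega) in H^1(Omega). *)
Definition H10 Omega u : Prop :=
  L2 Omega u /\
  exists2 g, weak_gradient Omega u g &
  exists psi : nat -> E -> R[i],
    [/\ forall n, test_function Omega (psi n),
        sqL2norm Omega (fun x => u x - psi n x) @[n --> \oo] --> 0%E &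
        forall i, sqL2norm Omega (fun x => g i x - cpartial i (psi n) x)
          @[n --> \oo] --> 0%E].

(* The domain of - Delta + V with Dirichlet boundary conditions, which is also
   the space of initial data. *)
Definition operator_domain Omega u : Prop := H10 Omega u /\ H2 Omega u.

(* Delta u - V u = f on Omega, in the sense of distributions. *)
Definition schrodinger_eq Omega V u f : Prop :=
  forall psi, test_function Omega psi ->
    cintegral Omega (fun x => u x * laplacian psi x - (V x)%:C * u x * psi x) =
    cintegral Omega (fun x => f x * psi x).

(* (- Delta + V) phi = l phi *)
Definition eigenfunction Omega V (l : R) phi : Prop :=
  operator_domain Omega phi /\
  schrodinger_eq Omega V phi (fun x => - l%:C * phi x).

Definition orthonormal_basis Omega (phi : nat -> E -> R[i]) : Prop :=
  [/\ forall j, L2 Omega (phi j),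
      forall j k, L2inner Omega (phi j) (phi k) = (j == k)%:R &
      forall f, L2 Omega f ->
        sqL2norm Omega
          (fun x => f x - \sum_(j < n) L2inner Omega f (phi j) * phi j x)
          @[n --> \oo] --> 0%E].

Definition eigenspace_index (lam : nat -> R) (l : R) : set nat :=
  [set j | lam j = l].

(* The index j stands for j + 1 in {1, 2, ...}. Multiplicities are finite, as
   they always are on a bounded domain; so each inner sum in
   spectral_quotient is a finite sum. *)
Definition spectral_basis Omega V (lam : nat -> R) (phi : nat -> E -> R[i]) :
    Prop :=
  [/\ orthonormal_basis Omega phi,
      forall j, eigenfunction Omega V (lam j) (phi j) &
      forall l, finite_set (eigenspace_index lam l)].

(* u is the solution, C^1 in time with values in L^2(Omega), of
   i u' = Delta u - V u, u = 0 on the boundary, u(0) = u0, and du is its time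
   derivative. *)
Record schrodinger_solution Omega V (u0 : E -> R[i]) (u du : R -> E -> R[i]) :
    Prop := SchrodingerSolution {
  solution_L2 : forall t, L2 Omega (u t) ;
  solution_dL2 : forall t, L2 Omega (du t) ;
  solution_deriv : forall t,
    sqL2norm Omega (fun x => (h^-1)%:C * (u (t + h) x - u t x) - du t x)
      @[h --> 0^'] --> 0%E ;
  solution_C1 : forall t,
    sqL2norm Omega (fun x => du s x - du t x) @[s --> t] --> 0%E ;
  solution_boundary : forall t, H10 Omega (u t) ;
  solution_equation : forall t,
    schrodinger_eq Omega V (u t) (fun x => (0 +i* 1) * du t x) ;
  solution_initial : sqL2norm Omega (fun x => u 0 x - u0 x) = 0%E }.

(* The data for which the observability quotient is defined: the initial
   datum is in the domain and u'(0) is not zero. *)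
Definition observable_solution Omega V (u du : R -> E -> R[i]) : Prop :=
  exists u0, [/\ operator_domain Omega u0,
    schrodinger_solution Omega V u0 u du & sqL2norm Omega (du 0) != 0%E].

Definition time_average Omega (omega : set E) (du : R -> E -> R[i]) (T : R) :
    \bar R :=
  ((T^-1)%:E *
   ((\int[lebesgue_measure]_(t in `[0%R, T]) sqL2norm omega (du t)) /
    sqL2norm Omega (du 0%R)))%E.

Definition observability_constant Omega V (omega : set E) : \bar R :=
  ereal_inf [set r | exists (u du : R -> E -> R[i]),
    observable_solution Omega V u du /\
    r = lim (time_average Omega omega du T @[T --> +oo])].

Definition ell2 (c : nat -> R[i]) : Prop :=
  (\sum_(0 <= k <oo) (sqnorm (c k))%:E < +oo)%E.

Definition spectral_quotient (lam : nat -> R) (phi : nat -> E -> R[i])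
    (omega : set E) (c : nat -> R[i]) : \bar R :=
  ((\int[mu]_(x in omega) \esum_(l in range lam)
      (sqnorm (\sum_(k \in eigenspace_index lam l) c k * phi k x)%R)%:E) /
   (\sum_(0 <= k <oo) (sqnorm (c k))%:E))%E.

End function_spaces.

(* Main.v *)
Require Import Defs.
From mathcomp Require Import all_boot all_order all_algebra.
From mathcomp Require Import all_classical all_reals all_analysis.
From mathcomp Require Import complex.
From mathcomp Require Import measurable_realfun.
From mathcomp Require Import ring lra.

Import Order.TTheory GRing.Theory Num.Theory.
Import numFieldNormedType.Exports.

Local Open Scope classical_set_scope.
Local Open Scope ring_scope.
Local Open Scope complex_scope.

Set Implicit Arguments.
Unset Strict Implicit.
Unset Printing Implicit Defensive.

(** Expand the time derivative of a solution in the eigenbasis. The operator is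
    symmetric on H^1_0 because V is real (schrodinger_symmetric), so pairing
    the equation with phi_j gives the scalar equation u_j' = i lam_j u_j, hence
    du(t) = sum_j e^(i lam_j t) c_j phi_j with c_j the coefficients of du(0)
    (solution_coef) and, by Parseval, ||du(0)||^2 = sum_j |c_j|^2.

    Group the terms by distinct eigenvalues, du(t) = sum_l e^(i l t) F_l with
    F_l = sum_(lam_k = l) c_k phi_k. For finitely many terms, expanding
    ||du(t)||^2 on omega produces phases e^(i (l - l') t); their time means
    tend to 0 unless l = l', so that only sum_l ||F_l||^2 on omega survives
    (time_mean_evolution). The passage to infinitely many terms rests on two
    facts. The error of truncating the expansion of du(t) after N terms is the
    tail of sum_j |c_j|^2, which is the same at all times since the phases have
    modulus one. And the functional c |-> sum_l ||F_l||^2 on omega is a sum of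
    squared seminorms that is at most sum_j |c_j|^2 (spectral_series_le), so it
    changes little under the same truncation (spectral_truncate_dist). All such
    comparisons use |x|^2 <= (1 + e) |y|^2 + (1 + 1/e) |x - y|^2 in the role of
    the triangle inequality (sqnorm_young, young_dist).

    Thus the time average of every solution converges to the spectral quotient
    of the coefficients c of du(0) (time_average_cvg), which bounds the
    observability constant from below. Conversely, the quotient of an arbitrary
    square-summable c is the limit of the quotients of its truncations, and
    those are attained by explicit solutions, namely finite sums of
    e^(i lam_j t) (c_j / (i lam_j)) phi_j. Only finite sums have to be shown to
    be solutions, so no regularity question arises. *)

(** * Lebesgue measurability of open subsets of R^n *)

Section open_measurable.
Variables (R : realType) (d : nat).
Local Notation E := 'rV[R]_d.+1.
Local Notation measurableE := (@measurable _ (lebesgue_space R d)).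

Definition replace (x : E) (i : 'I_d.+1) (a : R) : E :=
  \row_j (if j == i then a else x 0 j).

Definition cut_below i a (p : E * E) : E * E :=
  (p.1, replace p.2 i (Num.min (p.2 0 i) a)).

Definition cut_above i a (p : E * E) : E * E :=
  (replace p.1 i (Num.max (p.1 0 i) a), p.2).

Lemma box_cut_below i a p : box p `&` [set x | x 0 i <= a] `<=` box (cut_below i a p).
Proof.
move=> x [px /= xa] j; rewrite mxE; have /andP[-> xq] := px j.
by case: eqP => [ji|_] //=; rewrite le_min -ji xq /= ji.
Qed.

Lemma box_cut_above i a p : box p `&` ~` [set x | x 0 i <= a] `<=` box (cut_above i a p).
Proof.
move=> x [px /= /negP]; rewrite -ltNge => xa j; rewrite mxE.
have /andP[px0 ->] := px j; rewrite andbT.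
by case: eqP => [ji|_] //=; rewrite gt_max -ji px0 /= ji.
Qed.

(** The two pieces share all sides but the i-th, and the lengths of their i-th
    sides, one of which may be 0, add up. *)
Lemma box_volume_cut i a p :
  (box_volume p = box_volume (cut_below i a p) + box_volume (cut_above i a p))%E.
Proof.
rewrite /box_volume -EFinD; congr (_%:E).
rewrite (bigD1 i)//= [X in _ = X + _](bigD1 i)//= [X in _ = _ + X](bigD1 i)//=.
rewrite !mxE eqxx.
under [X in _ = _ * X + _]eq_bigr => j ji do rewrite mxE (negbTE ji).
under [X in _ = _ + _ * X]eq_bigr => j ji do rewrite mxE (negbTE ji).
rewrite -mulrDl; congr (_ * _).
rewrite /Num.max /Num.min.
by repeat case: ifPn => //; lra.
Qed.

(** Cutting every box of a cover of X along the hyperplane gives covers of the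
    two parts of X with the same total volume: Caratheodory's criterion. *)
Lemma measurable_halfspace i a : measurableE [set x : E | x 0 i <= a].
Proof.
apply: le_caratheodory_measurable => X.
apply: le_ereal_inf_tmp => _ [F XF <-].
under eq_eseriesr do rewrite (box_volume_cut i a).
rewrite nneseriesD; [|by move=> *; exact: box_volume_ge0..].
apply: leeD; apply: ereal_inf_lbound.
- exists (cut_below i a \o F) => // x [/XF[k _ Fx] xa]; exists k => //.
  exact: box_cut_below.
- exists (cut_above i a \o F) => // x [/XF[k _ Fx] xa]; exists k => //.
  exact: box_cut_above.
Qed.

Lemma measurable_box p : measurableE (box p).
Proof.
have -> : box p = \bigcap_(i in [set: 'I_d.+1])
    (~` [set x : lebesgue_space R d | x 0 i <= p.1 0 i] `&` [set x | x 0 i <= p.2 0 i]).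
  apply/seteqP; split => [x px i _ /=|x px i].
    have /andP[+ xq] := px i; by rewrite ltNge => /negP.
  by have [/= /negP + ->] := px i I; rewrite -ltNge => ->.
apply: fin_bigcap_measurable => [|i _]; first exact: finite_finset.
by apply: measurableI; [apply: measurableC|]; exact: measurable_halfspace.
Qed.

(** An open set is a countable union of boxes with rational corners. All of
    the L^2 theory on Omega starts here: measurability of a function on a set
    says nothing unless the set is measurable. *)
Lemma open_measurable_Rn (O : set E) : open O -> measurableE O.
Proof.
move=> oO.
pose B (pq : 'rV[rat]_d.+1 * 'rV[rat]_d.+1) : E * E :=
  (map_mx ratr pq.1, map_mx ratr pq.2).
have -> : O = \bigcup_pq (if `[< box (B pq) `<=` O >] then box (B pq) else set0).
  apply/seteqP; split => [x Ox|x [pq _]]; last first.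
    by case: asboolP => // BO; exact: BO.
  have /nbhs_ballP[e /= e0 xeO] := open_nbhs_nbhs (conj oO Ox).
  have lo i : {r : rat | x 0 i - e < ratr r < x 0 i}.
    have xe : x 0 i - e < x 0 i by rewrite ltrBlDr ltrDl.
    by have /cid[r] := rat_in_itvoo xe; rewrite in_itv/=; exists r.
  have hi i : {r : rat | x 0 i < ratr r < x 0 i + e}.
    have xe : x 0 i < x 0 i + e by rewrite ltrDl.
    by have /cid[r] := rat_in_itvoo xe; rewrite in_itv/=; exists r.
  exists (\row_i sval (lo i), \row_i sval (hi i)) => //.
  case: asboolP => [_ i|]; last first.
    case=> y yB; apply: xeO; split => // i j; rewrite ord1.
    have := yB j; rewrite !mxE; case: (lo j) (hi j) => p /= /andP[p1 p2] [q /= /andP[q1 q2]].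
    rewrite /ball /= ltr_norml; lra.
  by rewrite !mxE; case: (lo i) (hi i) => p /= /andP[p1 ->] [q /= /andP[/ltW-> ?]].
apply: countable_bigcupT_measurable => [|pq]; first exact: countableP.
by case: asboolP => _; [exact: measurable_box | exact: measurable0].
Qed.

Lemma bounded_finite_measure (O : set E) :
  bounded_set O -> (lebesgue_Rn (O : set (lebesgue_space R d)) < +oo)%E.
Proof.
move=> [M [Mr]] /(_ (M + 1)); rewrite ltrDl ltr01 => /(_ isT) OM.
pose p : E * E := (const_mx (- (M + 1) - 1), const_mx (M + 1)).
apply: (@le_lt_trans _ _ (box_volume p)); last exact: ltry.
(* The box (0, 0) is empty and pads the cover by the single box p. *)
pose F k := if k is 0%N then p else (0, 0) : E * E.
have F0 k : (0 < k)%N -> box_volume (F k) = 0%E.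
  by case: k => // k _; rewrite /box_volume big_ord_recl /= subrr maxxx mul0r.
have -> : box_volume p = (\sum_(0 <= k <oo) box_volume (F k))%E.
  rewrite (nneseries_split _ 1); last by move=> *; exact: box_volume_ge0.
  rewrite big_mkord big_ord1 eseries0 ?adde0// => i i1 _.
  by rewrite F0.
apply: ereal_inf_lbound; exists F => // x Ox; exists 0%N => //= i; rewrite !mxE.
have xi : `|x 0 i| <= M + 1.
  apply: le_trans (OM _ Ox); rewrite [leRHS]/Num.norm/= mx_normrE.
  exact: (le_bigmax _ (fun ij : 'I_1 * 'I_d.+1 => `|x ij.1 ij.2|) (0, i)).
move: xi; rewrite ler_norml; lra.
Qed.

Lemma continuous_measurable_Rn (D : set (lebesgue_space R d)) (f : E -> R) :
  continuous f -> measurable_fun D (f : lebesgue_space R d -> R).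
Proof.
move=> cf mD; apply: (measurability _ (measurable_realfun.RGenOpens.measurableE R)); last exact: mD.
move=> _ [_ [a [b ->] <-]]; apply: measurableI; first exact: mD.
apply: open_measurable_Rn.
by apply: open_comp => [x _|]; [exact: cf | exact: interval_open].
Qed.

End open_measurable.

(** * Square-integrable complex functions *)

Section complex_numbers.
Variable R : realType.
Implicit Types x y z : R[i].
Local Notation Re := complex.Re.
Local Notation Im := complex.Im.

Lemma Re_addc x y : Re (x + y) = Re x + Re y. Proof. by case: x y => [? ?] []. Qed.
Lemma Im_addc x y : Im (x + y) = Im x + Im y. Proof. by case: x y => [? ?] []. Qed.
Lemma Re_oppc x : Re (- x) = - Re x. Proof. by case: x. Qed.
Lemma Im_oppc x : Im (- x) = - Im x. Proof. by case: x. Qed.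
Lemma Re_mulc x y : Re (x * y) = Re x * Re y - Im x * Im y.
Proof. by case: x y => [? ?] []. Qed.
Lemma Im_mulc x y : Im (x * y) = Re x * Im y + Im x * Re y.
Proof. by case: x y => [? ?] []. Qed.
Lemma Re_conjc x : Re (conjc x) = Re x. Proof. by case: x. Qed.
Lemma Im_conjc x : Im (conjc x) = - Im x. Proof. by case: x. Qed.

Lemma Re_sumc I (s : seq I) (F : I -> R[i]) :
  Re (\sum_(i <- s) F i) = \sum_(i <- s) Re (F i).
Proof. exact: (big_morph _ Re_addc). Qed.

Lemma conjcB x y : conjc (x - y) = conjc x - conjc y.
Proof. exact: rmorphB. Qed.
Lemma conjcM x y : conjc (x * y) = conjc x * conjc y.
Proof. exact: rmorphM. Qed.

Definition ReImE := (Re_addc, Im_addc, Re_oppc, Im_oppc, Re_mulc, Im_mulc, Re_conjc, Im_conjc).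

Lemma complexP x y : Re x = Re y -> Im x = Im y -> x = y.
Proof. by case: x y => [a b] [c e] /= -> ->. Qed.

Lemma sqnorm_ge0 z : 0 <= sqnorm z.
Proof. by rewrite addr_ge0 ?sqr_ge0. Qed.

Lemma sqnorm0 : sqnorm (0 : R[i]) = 0.
Proof. by rewrite /sqnorm /= expr0n /= addr0. Qed.

Lemma sqnorm_eq0 z : (sqnorm z == 0) = (z == 0).
Proof.
by rewrite paddr_eq0 ?sqr_ge0// !sqrf_eq0 eq_complex.
Qed.

Lemma sqnormM x y : sqnorm (x * y) = sqnorm x * sqnorm y.
Proof. by rewrite /sqnorm !ReImE; ring. Qed.

Lemma sqnormJ z : sqnorm (conjc z) = sqnorm z.
Proof. by rewrite /sqnorm !ReImE; ring. Qed.

Lemma sqnormN z : sqnorm (- z) = sqnorm z.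
Proof. by rewrite /sqnorm !ReImE; ring. Qed.

Lemma sqnormR (r : R) : sqnorm r%:C = r ^+ 2.
Proof. by rewrite /sqnorm /= expr0n /= addr0. Qed.

Lemma mulcJE z : z * conjc z = (sqnorm z)%:C.
Proof. by apply: complexP; rewrite !ReImE /sqnorm /=; ring. Qed.

(** For real numbers the difference of the two sides is a square. Being
    quadratic, this substitute for the triangle inequality survives integration
    and summation as it stands. *)
Lemma sqnorm_young (e : R) x y : 0 < e ->
  sqnorm x <= (1 + e) * sqnorm y + (1 + e^-1) * sqnorm (x - y).
Proof.
move=> e0.
have real_young (a b : R) : a ^+ 2 <= (1 + e) * b ^+ 2 + (1 + e^-1) * (a - b) ^+ 2.
  rewrite -subr_ge0.
  rewrite (_ : _ - _ = e * (b - e^-1 * (a - b)) ^+ 2); last by field; rewrite gt_eqF.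
  by rewrite mulr_ge0 ?sqr_ge0// ltW.
by rewrite /sqnorm !ReImE !mulrDr addrACA lerD ?real_young.
Qed.

Lemma sqnormD_le x y : sqnorm (x + y) <= 2 * sqnorm x + 2 * sqnorm y.
Proof.
have := @sqnorm_young 1 (x + y) x ltr01.
by rewrite (addrC x y) addrK invr1 (addrC y).
Qed.

End complex_numbers.

Section L2_theory.
Variables (R : realType) (d : nat).
Local Notation E := 'rV[R]_d.+1.
Local Notation T := (lebesgue_space R d).
Local Notation mu := (@lebesgue_Rn R d).
Local Notation Re := complex.Re.
Local Notation Im := complex.Im.
Variable A : set T.
Hypothesis mA : measurable A.
Implicit Types (z : R[i]) (f g h : E -> R[i]).

Definition cintegrable f : Prop :=
  mu.-integrable A (fun x : T => (Re (f x))%:E) /\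
  mu.-integrable A (fun x : T => (Im (f x))%:E).

Lemma integrableZ_EFin (r : R) (h : T -> R) : mu.-integrable A (EFin \o h) ->
  mu.-integrable A (EFin \o (fun x => r * h x)).
Proof. by move=> hi; exact: (integrableZl mA r hi). Qed.

Lemma cintegrableD f g :
  cintegrable f -> cintegrable g -> cintegrable (fun x => f x + g x).
Proof.
move=> [f1 f2] [g1 g2]; split.
  by under eq_fun do rewrite Re_addc EFinD; exact: integrableD.
by under eq_fun do rewrite Im_addc EFinD; exact: integrableD.
Qed.

Lemma cintegrableZ z f : cintegrable f -> cintegrable (fun x => z * f x).
Proof.
move=> [f1 f2]; split.
  under eq_fun do rewrite Re_mulc EFinB !EFinM.
  by apply: integrableB => //; exact: integrableZl.
under eq_fun do rewrite Im_mulc EFinD !EFinM.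
by apply: integrableD => //; exact: integrableZl.
Qed.

Lemma cintegralD f g : cintegrable f -> cintegrable g ->
  cintegral A (fun x => f x + g x) = cintegral A f + cintegral A g.
Proof.
move=> [f1 f2] [g1 g2]; apply: complexP; rewrite ?ReImE /=.
  by under eq_Rintegral do rewrite Re_addc; rewrite RintegralD.
by under eq_Rintegral do rewrite Im_addc; rewrite RintegralD.
Qed.

Lemma cintegralZ z f : cintegrable f ->
  cintegral A (fun x => z * f x) = z * cintegral A f.
Proof.
move=> [f1 f2]; apply: complexP; rewrite ?ReImE /=.
  under eq_Rintegral do rewrite Re_mulc.
  by rewrite RintegralB ?RintegralZl//; exact: integrableZ_EFin.
under eq_Rintegral do rewrite Im_mulc.
by rewrite RintegralD ?RintegralZl//; exact: integrableZ_EFin.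
Qed.

Lemma cintegralJ f : cintegrable f ->
  cintegral A (fun x => conjc (f x)) = conjc (cintegral A f).
Proof.
move=> [f1 f2]; apply: complexP; rewrite ?ReImE /=.
  by under eq_Rintegral do rewrite Re_conjc.
under eq_Rintegral do rewrite Im_conjc -mulN1r.
by rewrite RintegralZl// mulN1r.
Qed.

Lemma cintegralN f : cintegrable f ->
  cintegral A (fun x => - f x) = - cintegral A f.
Proof.
move=> fi; under [X in cintegral _ X]eq_fun do rewrite -mulN1r.
by rewrite cintegralZ// mulN1r.
Qed.

Lemma cintegrableN f : cintegrable f -> cintegrable (fun x => - f x).
Proof. by move=> /(cintegrableZ (-1)); under eq_fun do rewrite mulN1r. Qed.

Lemma cintegral0 : cintegral A (fun=> 0) = 0.
Proof. by rewrite /cintegral /= !Rintegral_cst// !mul0r. Qed.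

Lemma cintegrable0 : cintegrable (fun=> 0).
Proof. by split; exact: integrable0. Qed.

Lemma cintegrable_sum I (s : seq I) (F : I -> E -> R[i]) :
  (forall i, cintegrable (F i)) -> cintegrable (fun x => \sum_(i <- s) F i x).
Proof.
move=> Fi; elim: s => [|i s IHs].
  by under eq_fun do rewrite big_nil; exact: cintegrable0.
by under eq_fun do rewrite big_cons; exact: cintegrableD.
Qed.

Lemma cintegral_sum I (s : seq I) (F : I -> E -> R[i]) :
  (forall i, cintegrable (F i)) ->
  cintegral A (fun x => \sum_(i <- s) F i x) = \sum_(i <- s) cintegral A (F i).
Proof.
move=> Fi; elim: s => [|i s IHs].
  by under eq_fun do rewrite big_nil; rewrite big_nil cintegral0.
under eq_fun do rewrite big_cons; rewrite big_cons cintegralD ?IHs//.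
exact: cintegrable_sum.
Qed.

Lemma L2E f : L2 A f -> [/\ measurable_fun A (fun x : T => Re (f x)),
  measurable_fun A (fun x : T => Im (f x)) & (sqL2norm A f < +oo)%E].
Proof. by []. Qed.

(** sqL2norm as a real number: the two agree on L^2, where sqL2norm is finite. *)
Definition L2sq f : R := \int[mu]_(x in A) sqnorm (f x).

Lemma measurable_sqnorm f :
  measurable_fun A (fun x : T => Re (f x)) -> measurable_fun A (fun x : T => Im (f x)) ->
  measurable_fun A (fun x : T => sqnorm (f x)).
Proof.
by move=> mr mi; apply: measurable_funD; exact: measurable_funX.
Qed.

Lemma L2_sqnorm_integrable f : L2 A f ->
  mu.-integrable A (fun x : T => (sqnorm (f x))%:E).
Proof.
move=> [mr mi fi]; apply/integrableP; split.
  by apply/measurable_EFinP; exact: measurable_sqnorm.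
under eq_integral do rewrite gee0_abs ?lee_fin ?sqnorm_ge0//.
exact: fi.
Qed.

Lemma L2P f : measurable_fun A (fun x : T => Re (f x)) ->
  measurable_fun A (fun x : T => Im (f x)) ->
  mu.-integrable A (fun x : T => (sqnorm (f x))%:E) -> L2 A f.
Proof.
move=> mr mi /integrableP[_]; split => //.
by under [sqL2norm _ _]eq_integral do rewrite -[_%:E]gee0_abs ?lee_fin ?sqnorm_ge0//.
Qed.

Lemma sqL2normE f : L2 A f -> sqL2norm A f = (L2sq f)%:E.
Proof.
move=> /L2_sqnorm_integrable fi; rewrite /L2sq /Rintegral fineK//.
exact: integrable_fin_num.
Qed.

Local Opaque L2.

Lemma L2sq_ge0 f : 0 <= L2sq f.
Proof. by apply: Rintegral_ge0 => x _; exact: sqnorm_ge0. Qed.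

Lemma le_L2 (g : E -> R) f : measurable_fun A (fun x : T => Re (f x)) ->
  measurable_fun A (fun x : T => Im (f x)) ->
  mu.-integrable A (fun x : T => (g x)%:E) ->
  (forall x, sqnorm (f x) <= g x) -> L2 A f.
Proof.
move=> mr mi gi fg; apply: L2P => //.
apply: (le_integrable mA _ _ gi).
  by apply/measurable_EFinP; exact: measurable_sqnorm.
move=> x _; rewrite lee_fin !ger0_norm// ?sqnorm_ge0//.
exact: le_trans (sqnorm_ge0 _) (fg x).
Qed.

Lemma L2Z z f : L2 A f -> L2 A (fun x => z * f x).
Proof.
move=> L2f; have [mr mi _] := L2E L2f.
apply: (@le_L2 (fun x => sqnorm z * sqnorm (f x))) => [| | |x]; last by rewrite sqnormM.
- under eq_fun do rewrite Re_mulc.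
  by apply: measurable_funB; exact: measurable_funM.
- under eq_fun do rewrite Im_mulc.
  by apply: measurable_funD; exact: measurable_funM.
- under eq_fun do rewrite EFinM.
  by apply: integrableZl => //; exact: L2_sqnorm_integrable.
Qed.

Lemma L2D f g : L2 A f -> L2 A g -> L2 A (fun x => f x + g x).
Proof.
move=> L2f L2g; have [mfr mfi _] := L2E L2f; have [mgr mgi _] := L2E L2g.
apply: (@le_L2 (fun x => 2 * sqnorm (f x) + 2 * sqnorm (g x))) => [| | |x].
- by under eq_fun do rewrite Re_addc; exact: measurable_funD.
- by under eq_fun do rewrite Im_addc; exact: measurable_funD.
- under eq_fun do rewrite EFinD !EFinM.
  by apply: integrableD => //; apply: integrableZl => //; exact: L2_sqnorm_integrable.
- exact: sqnormD_le.
Qed.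

Lemma L2J f : L2 A f -> L2 A (fun x => conjc (f x)).
Proof.
move=> L2f; have [mr mi _] := L2E L2f.
apply: (@le_L2 (fun x => sqnorm (f x))) => [| | |x]; last by rewrite sqnormJ.
- by under eq_fun do rewrite Re_conjc.
- by under eq_fun do rewrite Im_conjc; exact: measurable_funN.
- exact: L2_sqnorm_integrable.
Qed.

Lemma L2_0 : L2 A (fun=> 0).
Proof.
apply: (@le_L2 (fun=> 0)) => //=; first exact: integrable0.
by move=> _; rewrite sqnorm0.
Qed.

Lemma L2N f : L2 A f -> L2 A (fun x => - f x).
Proof. by move=> /(L2Z (-1)); under eq_fun do rewrite mulN1r. Qed.

Lemma L2B f g : L2 A f -> L2 A g -> L2 A (fun x => f x - g x).
Proof. by move=> L2f L2g; exact: (L2D L2f (L2N L2g)). Qed.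

Lemma L2_sum I (s : seq I) (F : I -> E -> R[i]) :
  (forall i, L2 A (F i)) -> L2 A (fun x => \sum_(i <- s) F i x).
Proof.
move=> Fi; elim: s => [|i s IHs].
  by under eq_fun do rewrite big_nil; exact: L2_0.
by under eq_fun do rewrite big_cons; exact: L2D.
Qed.

Lemma L2_cintegrableM f g : L2 A f -> L2 A g -> cintegrable (fun x => f x * g x).
Proof.
move=> L2f L2g; have [mfr mfi _] := L2E L2f; have [mgr mgi _] := L2E L2g.
have gi : mu.-integrable A (fun x : T => (sqnorm (f x) + sqnorm (g x))%:E).
  under eq_fun do rewrite EFinD.
  by apply: integrableD => //; exact: L2_sqnorm_integrable.
have AMGM (a b c e : R) : `|a * b - c * e| <= (a ^+ 2 + c ^+ 2) + (b ^+ 2 + e ^+ 2).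
  have := sqr_ge0 (a - b); have := sqr_ge0 (a + b).
  have := sqr_ge0 (c - e); have := sqr_ge0 (c + e).
  by rewrite !expr2 => h1 h2 h3 h4; rewrite ler_norml; apply/andP; split; nra.
split; apply: (le_integrable mA _ _ gi).
- apply/measurable_EFinP; under eq_fun do rewrite Re_mulc.
  by apply: measurable_funB; exact: measurable_funM.
- move=> x _; rewrite lee_fin Re_mulc (le_trans (AMGM _ _ _ _))//.
  exact: ler_norm.
- apply/measurable_EFinP; under eq_fun do rewrite Im_mulc.
  by apply: measurable_funD; exact: measurable_funM.
- move=> x _; rewrite lee_fin Im_mulc -[X in X + _]opprK addrC -mulrN.
  apply: le_trans (ler_norm _).
  rewrite (le_trans (AMGM _ _ _ _))// /sqnorm sqrrN; lra.
Qed.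

Lemma L2sq_L2inner f : L2 A f -> L2inner A f f = (L2sq f)%:C.
Proof.
move=> L2f; apply: complexP => /=.
  by apply: eq_Rintegral => x _; rewrite mulcJE.
by under eq_Rintegral do rewrite mulcJE /=; rewrite Rintegral_cst// mul0r.
Qed.

Lemma L2innerDl f g h : L2 A f -> L2 A g -> L2 A h ->
  L2inner A (fun x => f x + g x) h = L2inner A f h + L2inner A g h.
Proof.
move=> L2f L2g /L2J L2h; rewrite /L2inner.
by under [X in cintegral _ X]eq_fun do rewrite mulrDl;
  rewrite cintegralD//; exact: L2_cintegrableM.
Qed.

Lemma L2innerZl z f h : L2 A f -> L2 A h ->
  L2inner A (fun x => z * f x) h = z * L2inner A f h.
Proof.
move=> L2f /L2J L2h; rewrite /L2inner.
by under [X in cintegral _ X]eq_fun do rewrite -mulrA;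
  rewrite cintegralZ//; exact: L2_cintegrableM.
Qed.

Lemma L2innerJ f h : L2 A f -> L2 A h -> conjc (L2inner A f h) = L2inner A h f.
Proof.
move=> L2f /L2J L2h; rewrite /L2inner -cintegralJ; last exact: L2_cintegrableM.
by congr cintegral; apply/funext => x; rewrite rmorphM/= conjcK mulrC.
Qed.

Lemma L2innerBl f g h : L2 A f -> L2 A g -> L2 A h ->
  L2inner A (fun x => f x - g x) h = L2inner A f h - L2inner A g h.
Proof.
move=> L2f L2g L2h; rewrite (L2innerDl L2f (L2N L2g) L2h).
have -> : (fun x => - g x) = (fun x => -1 * g x) by apply/funext => x; rewrite mulN1r.
by rewrite (L2innerZl _ L2g L2h) mulN1r.
Qed.

Lemma L2innerBr f g h : L2 A f -> L2 A g -> L2 A h ->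
  L2inner A h (fun x => f x - g x) = L2inner A h f - L2inner A h g.
Proof.
move=> L2f L2g L2h; rewrite -(L2innerJ (L2B L2f L2g) L2h) (L2innerBl L2f L2g L2h).
by rewrite conjcB (L2innerJ L2f L2h) (L2innerJ L2g L2h).
Qed.

Lemma L2innerZr z f h : L2 A f -> L2 A h ->
  L2inner A h (fun x => z * f x) = conjc z * L2inner A h f.
Proof.
move=> L2f L2h; rewrite -(L2innerJ (L2Z z L2f) L2h) (L2innerZl _ L2f L2h).
by rewrite conjcM (L2innerJ L2f L2h).
Qed.

Lemma L2inner_suml I (s : seq I) (F : I -> E -> R[i]) h :
  (forall i, L2 A (F i)) -> L2 A h ->
  L2inner A (fun x => \sum_(i <- s) F i x) h = \sum_(i <- s) L2inner A (F i) h.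
Proof.
move=> L2F /L2J L2h; rewrite /L2inner.
under [X in cintegral _ X]eq_fun do rewrite mulr_suml.
by rewrite cintegral_sum// => i; exact: L2_cintegrableM.
Qed.

Lemma L2inner_sumr I (s : seq I) (F : I -> E -> R[i]) h :
  (forall i, L2 A (F i)) -> L2 A h ->
  L2inner A h (fun x => \sum_(i <- s) F i x) = \sum_(i <- s) L2inner A h (F i).
Proof.
move=> L2F L2h; rewrite -(L2innerJ (L2_sum s L2F) L2h) (L2inner_suml s L2F L2h).
by rewrite rmorph_sum; apply: eq_bigr => i _; exact: L2innerJ.
Qed.

Lemma L2sqZ z f : L2 A f -> L2sq (fun x => z * f x) = sqnorm z * L2sq f.
Proof.
move=> /L2_sqnorm_integrable L2f; rewrite /L2sq; under eq_Rintegral do rewrite sqnormM.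
by rewrite RintegralZl.
Qed.

Lemma L2sq_young (e : R) f g : 0 < e -> L2 A f -> L2 A g ->
  L2sq f <= (1 + e) * L2sq g + (1 + e^-1) * L2sq (fun x => f x - g x).
Proof.
move=> e0 L2f L2g; have L2h := L2B L2f L2g.
have Zi (r : R) h : L2 A h -> mu.-integrable A (fun x : T => (r * sqnorm (h x))%:E).
  move=> /L2_sqnorm_integrable hi.
  by under eq_fun do rewrite EFinM; exact: integrableZl.
rewrite /L2sq -!RintegralZl//; [|exact: L2_sqnorm_integrable..].
rewrite -RintegralD//; [|exact: Zi..].
apply: le_Rintegral => //; [exact: L2_sqnorm_integrable| |].
  exact: (integrableD mA (Zi _ _ L2g) (Zi _ _ L2h)).
by move=> x _; exact: sqnorm_young.
Qed.

Lemma L2sqB f g : L2 A f -> L2 A g ->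
  L2sq (fun x => f x - g x) = L2sq f - 2 * Re (L2inner A f g) + L2sq g.
Proof.
move=> L2f L2g; have L2h := L2B L2f L2g.
apply: complexI; rewrite -(L2sq_L2inner L2h) (L2innerBl L2f L2g L2h).
rewrite (L2innerBr L2f L2g L2f) (L2innerBr L2f L2g L2g).
rewrite (L2sq_L2inner L2f) (L2sq_L2inner L2g) -(L2innerJ L2f L2g).
by apply: complexP; rewrite !ReImE /=; ring.
Qed.

(** With z the inner product, t |-> ||f - t z g||^2 is a nonnegative quadratic
    polynomial. Evaluate it at its minimum if g has positive norm; otherwise it
    is affine, and z <> 0 would make it negative for large t. *)
Lemma cauchy_schwarz f g : L2 A f -> L2 A g ->
  sqnorm (L2inner A f g) <= L2sq f * L2sq g.
Proof.
move=> L2f L2g; set z := L2inner A f g.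
have quad (t : R) : 0 <= L2sq f - 2 * t * sqnorm z + t ^+ 2 * sqnorm z * L2sq g.
  have := L2sq_ge0 (fun x => f x - (t%:C * z) * g x).
  rewrite (L2sqB L2f (L2Z _ L2g)) (L2innerZr _ L2g L2f) (L2sqZ _ L2g) sqnormM sqnormR -/z.
  rewrite (_ : Re _ = t * sqnorm z); last by rewrite !ReImE /sqnorm /=; ring.
  by move=> /le_trans; apply; rewrite le_eqVlt; apply/orP; left; apply/eqP; ring.
have g0 := L2sq_ge0 g; have [gp|] := ltP 0 (L2sq g).
  have := quad (L2sq g)^-1; rewrite -(pmulr_rge0 _ gp).
  rewrite (_ : L2sq g * _ = L2sq f * L2sq g - sqnorm z) ?subr_ge0//.
  by field; rewrite gt_eqF.
move=> g1; have {g0 g1} g0 : L2sq g = 0 by apply/eqP; rewrite eq_le g1 g0.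
rewrite g0 mulr0 leNgt; apply/negP => z0.
(* The affine polynomial takes the value - ||f||^2 - 2 there. *)
have := quad ((L2sq f + 1) / sqnorm z); rewrite g0 mulr0 addr0.
rewrite (_ : _ - _ = - L2sq f - 2); last by field; rewrite gt_eqF.
have := L2sq_ge0 f; lra.
Qed.

Lemma L2sq_sum (I : Type) (s : seq I) (z : I -> R[i]) (F : I -> E -> R[i]) :
  (forall i, L2 A (F i)) ->
  L2sq (fun x => \sum_(i <- s) z i * F i x) =
  \sum_(i <- s) \sum_(j <- s) Re (z i * conjc (z j) * L2inner A (F i) (F j)).
Proof.
move=> L2F; have L2zF i : L2 A (fun x => z i * F i x) by exact: L2Z.
apply: (@complexI R); rewrite -(L2sq_L2inner (L2_sum s L2zF)).
have eqC : L2inner A (fun x => \sum_(i <- s) z i * F i x)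
                     (fun x => \sum_(i <- s) z i * F i x) =
  \sum_(i <- s) \sum_(j <- s) z i * conjc (z j) * L2inner A (F i) (F j).
  rewrite (L2inner_suml s L2zF (L2_sum s L2zF)).
  apply: eq_bigr => i _; rewrite (L2inner_sumr s L2zF (L2zF i)).
  apply: eq_bigr => j _.
  by rewrite (L2innerZl _ (L2F i) (L2zF j)) (L2innerZr _ (L2F j) (L2F i)) mulrA.
apply: complexP; last by rewrite (L2sq_L2inner (L2_sum s L2zF)).
by rewrite eqC Re_sumc; apply: eq_bigr => i _; rewrite Re_sumc.
Qed.

End L2_theory.

Section L2_restriction.
Local Opaque L2.
Variables (R : realType) (d : nat).
Local Notation E := 'rV[R]_d.+1.
Local Notation T := (lebesgue_space R d).
Variables (A B : set T).
Hypotheses (mA : measurable A) (mB : measurable B) (AB : A `<=` B).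

Lemma L2S (f : E -> R[i]) : L2 B f -> L2 A f.
Proof.
move=> L2f; have [mr mi _] := L2E L2f.
apply: L2P; [exact: (measurable_funS mB AB mr)|exact: (measurable_funS mB AB mi)|].
exact: (integrableS mB mA AB (L2_sqnorm_integrable L2f)).
Qed.

Lemma L2sqS (f : E -> R[i]) : L2 B f -> L2sq A f <= L2sq B f.
Proof.
move=> L2f; rewrite -lee_fin -(sqL2normE mB L2f) -(sqL2normE mA (L2S L2f)).
have [mr mi _] := L2E L2f.
apply: (@ge0_subset_integral _ _ _ (@lebesgue_Rn R d)) => //; last by move=> x _; rewrite lee_fin sqnorm_ge0.
by apply/measurable_EFinP; exact: measurable_sqnorm.
Qed.

End L2_restriction.

(** * The Dirichlet Schrodinger operator in weak form *)

Section L2_convergence.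
Variables (R : realType) (d : nat).
Local Notation E := 'rV[R]_d.+1.
Local Notation T := (lebesgue_space R d).
Variable A : set T.
Hypothesis mA : measurable A.
Context (I : Type) (F : set_system I) {FF : Filter F}.

Lemma sqL2norm_cvg0P (f : I -> E -> R[i]) : (forall t, L2 A (f t)) ->
  (sqL2norm A (f t) @[t --> F] --> 0%E) <-> (L2sq A (f t) @[t --> F] --> 0).
Proof.
move=> L2f; have -> : (fun t => sqL2norm A (f t)) = EFin \o (fun t => L2sq A (f t)).
  by apply/funext => t; rewrite (sqL2normE mA (L2f t)).
split => [/fine_cvgP[_ f0]|f0]; first exact: f0.
by apply/fine_cvgP; split => //; apply: nearW.
Qed.

(** Convergence to 0 of a complex function, expressed over the reals: limits of
    inner products are compared by Cauchy-Schwarz, which bounds sqnorm. *)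
Definition cvanish (z : I -> R[i]) : Prop := sqnorm (z t) @[t --> F] --> 0.

Lemma cvanish_le (z : I -> R[i]) (g : I -> R) :
  (forall t, sqnorm (z t) <= g t) -> g t @[t --> F] --> 0 -> cvanish z.
Proof.
move=> zg g0; apply: (@squeeze_cvgr _ _ _ _ (fun=> 0) g) => //; last exact: cvg_cst.
by apply: nearW => t; rewrite sqnorm_ge0 zg.
Qed.

Lemma cvanishD (z w : I -> R[i]) :
  cvanish z -> cvanish w -> cvanish (fun t => z t + w t).
Proof.
move=> z0 w0; apply: (@cvanish_le _ (fun t => 2 * sqnorm (z t) + 2 * sqnorm (w t))).
  by move=> t; exact: sqnormD_le.
rewrite -[0](addr0 0) -{1}(mulr0 2) -{2}(mulr0 2).
by apply: cvgD; apply: cvgMr.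
Qed.

Lemma cvanish_sum (J : Type) (s : seq J) (z : J -> I -> R[i]) :
  (forall j, cvanish (z j)) -> cvanish (fun t => \sum_(j <- s) z j t).
Proof.
move=> z0; elim: s => [|j s IHs].
  by rewrite /cvanish; under eq_fun do rewrite big_nil sqnorm0; exact: cvg_cst.
by under [X in cvanish X]eq_fun do rewrite big_cons; exact: cvanishD.
Qed.

Lemma L2inner_cvanish (f : E -> R[i]) (g : I -> E -> R[i]) :
  L2 A f -> (forall t, L2 A (g t)) -> sqL2norm A (g t) @[t --> F] --> 0%E ->
  cvanish (fun t => L2inner A f (g t)).
Proof.
move=> L2f L2g /(sqL2norm_cvg0P L2g) g0.
apply: (@cvanish_le _ (fun t => L2sq A f * L2sq A (g t))).
  by move=> t; exact: cauchy_schwarz.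
by rewrite -(mulr0 (L2sq A f)); apply: cvgMr.
Qed.

End L2_convergence.

Section vanishing_complex.
Context (R : realType) (I : Type) (F : set_system I) {FF : Filter F}.
Local Notation Re := complex.Re.
Local Notation Im := complex.Im.

Lemma sqr_cvg0 (f : I -> R) : f t @[t --> F] --> 0 -> f t ^+ 2 @[t --> F] --> 0.
Proof.
move=> f0; rewrite -[X in _ --> X](mulr0 0); under eq_fun do rewrite expr2.
exact: cvgM.
Qed.

Lemma sqr_le_cvg0 (f g : I -> R) : (forall t, f t ^+ 2 <= g t) ->
  g t @[t --> F] --> 0 -> f t @[t --> F] --> 0.
Proof.
move=> fg g0; apply: norm_cvg0.
apply: (@squeeze_cvgr _ _ _ _ (fun=> 0) (fun t => Num.sqrt (g t))).
- by apply: nearW => t; rewrite normr_ge0 -sqrtr_sqr ler_wsqrtr.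
- exact: cvg_cst.
- by rewrite -(sqrtr0 R); apply: (cvg_comp _ _ g0); exact: sqrt_continuous.
Qed.

Lemma cvanish_Re (z : I -> R[i]) : cvanish F z -> Re (z t) @[t --> F] --> 0.
Proof. by apply: sqr_le_cvg0 => t; rewrite lerDl sqr_ge0. Qed.

Lemma cvanish_Im (z : I -> R[i]) : cvanish F z -> Im (z t) @[t --> F] --> 0.
Proof. by apply: sqr_le_cvg0 => t; rewrite lerDr sqr_ge0. Qed.

Lemma cvanishP (z : I -> R[i]) : Re (z t) @[t --> F] --> 0 ->
  Im (z t) @[t --> F] --> 0 -> cvanish F z.
Proof.
move=> /sqr_cvg0 z1 /sqr_cvg0 z2; rewrite /cvanish -[X in _ --> X](addr0 0).
exact: cvgD.
Qed.

Lemma cvanishZ (a : R[i]) (z : I -> R[i]) : cvanish F z -> cvanish F (fun t => a * z t).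
Proof.
move=> z0; rewrite /cvanish -[X in _ --> X](mulr0 (sqnorm a)).
rewrite (_ : (fun t => _) = (fun t => sqnorm a * sqnorm (z t))); first exact: cvgMr.
by apply/funext => t; rewrite sqnormM.
Qed.

Lemma cvanishB_Re (z : I -> R[i]) (l : R[i]) : cvanish F (fun t => z t - l) ->
  Re (z t) @[t --> F] --> Re l.
Proof.
move=> zl; have h : Re (z t - l) @[t --> F] --> 0 by exact: cvanish_Re.
rewrite (_ : (fun t => Re (z t)) = (fun t => Re (z t - l) + Re l)); last first.
  by apply/funext => t; rewrite !ReImE subrK.
by rewrite -[X in _ --> X]add0r; apply: cvgD h _; exact: cvg_cst.
Qed.

Lemma cvanishB_Im (z : I -> R[i]) (l : R[i]) : cvanish F (fun t => z t - l) ->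
  Im (z t) @[t --> F] --> Im l.
Proof.
move=> zl; have h : Im (z t - l) @[t --> F] --> 0 by exact: cvanish_Im.
rewrite (_ : (fun t => Im (z t)) = (fun t => Im (z t - l) + Im l)); last first.
  by apply/funext => t; rewrite !ReImE subrK.
by rewrite -[X in _ --> X]add0r; apply: cvgD h _; exact: cvg_cst.
Qed.

End vanishing_complex.

Section test_functions.
Variables (R : realType) (d : nat).
Local Notation E := 'rV[R]_d.+1.
Local Notation Re := complex.Re.
Local Notation Im := complex.Im.
Implicit Types (h k : E -> R) (psi : E -> R[i]) (Omega : set E).

Lemma smooth_continuous h : smooth h ->
  forall s, continuous (foldr (@partial R d) h s).
Proof. by move=> sh s; case: (sh s). Qed.

Lemma smooth_derivable s h i x : smooth h ->
  derivable (foldr (@partial R d) h s) x (delta_mx 0 i).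
Proof. by move=> /(_ s)[]. Qed.

Lemma eq_smooth h k : h =1 k -> smooth k -> smooth h.
Proof. by move=> /funext ->. Qed.

Lemma foldr_partialD s h k : smooth h -> smooth k ->
  foldr (@partial R d) (fun x => h x + k x) s =
  (fun x => foldr (@partial R d) h s x + foldr (@partial R d) k s x).
Proof.
move=> sh sk; elim: s => [//|i s IHs] /=; rewrite IHs; apply/funext => x.
by rewrite /partial -deriveD//; exact: smooth_derivable.
Qed.

Lemma foldr_partialZ s (a : R) h : smooth h ->
  foldr (@partial R d) (fun x => a * h x) s = (fun x => a * foldr (@partial R d) h s x).
Proof.
move=> sh; elim: s => [//|i s IHs] /=; rewrite IHs; apply/funext => x.
by rewrite /partial -deriveMl//; exact: smooth_derivable.
Qed.

Lemma smoothD h k : smooth h -> smooth k -> smooth (fun x => h x + k x).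
Proof.
move=> sh sk s /=; rewrite foldr_partialD//; split.
  by move=> x; exact: (cvgD (smooth_continuous sh (x:=x)) (smooth_continuous sk (x:=x))).
by move=> i x; apply: derivableD; exact: smooth_derivable.
Qed.

Lemma smoothZ (a : R) h : smooth h -> smooth (fun x => a * h x).
Proof.
move=> sh s /=; rewrite foldr_partialZ//; split.
  by move=> x; exact: (cvgMr (smooth_continuous sh (x:=x))).
by move=> i x; apply: (derivableZ (k := a)); exact: smooth_derivable.
Qed.

Lemma smooth_partial i h : smooth h -> smooth (partial i h).
Proof. by move=> sh s /=; have := sh (rcons s i); rewrite /= foldr_rcons. Qed.

Lemma partialD i h k : smooth h -> smooth k ->
  partial i (fun x => h x + k x) = (fun x => partial i h x + partial i k x).
Proof. by move=> sh sk; exact: (foldr_partialD [:: i] sh sk). Qed.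

Lemma partialZ i (a : R) h : smooth h ->
  partial i (fun x => a * h x) = (fun x => a * partial i h x).
Proof. by move=> sh; exact: (foldr_partialZ [:: i] a sh). Qed.

Lemma compact_closed_Rn (K : set E) : compact K -> closed K.
Proof. by apply: compact_closed; exact: norm_hausdorff. Qed.

Lemma test_functionD Omega psi chi : test_function Omega psi ->
  test_function Omega chi -> test_function Omega (fun x => psi x + chi x).
Proof.
move=> [r1 i1 [K1 [cK1 K1O] psi0]] [r2 i2 [K2 [cK2 K2O] chi0]]; split.
- exact: (eq_smooth (fun x => Re_addc _ _) (smoothD r1 r2)).
- exact: (eq_smooth (fun x => Im_addc _ _) (smoothD i1 i2)).
- exists (K1 `|` K2).
    split; last by rewrite subUset.
    exact: compactU.
  move=> x xK; rewrite psi0 ?chi0 ?addr0//; apply: contra_not xK; by [left|right].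
Qed.

Lemma test_functionZ Omega (z : R[i]) psi : test_function Omega psi ->
  test_function Omega (fun x => z * psi x).
Proof.
move=> [r1 i1 [K1 [cK1 K1O] psi0]]; split.
- apply: eq_smooth (smoothD (smoothZ (Re z) r1) (smoothZ (- Im z) i1)) => x.
  by rewrite Re_mulc mulNr.
- exact: (eq_smooth (fun x => Im_mulc _ _) (smoothD (smoothZ _ i1) (smoothZ _ r1))).
- by exists K1 => // x xK; rewrite psi0 ?mulr0.
Qed.

Lemma test_functionJ Omega psi : test_function Omega psi ->
  test_function Omega (fun x => conjc (psi x)).
Proof.
move=> [r1 i1 [K1 [cK1 K1O] psi0]]; split.
- exact: (eq_smooth (fun x => Re_conjc _) r1).
- by apply: eq_smooth (smoothZ (-1) i1) => x; rewrite Im_conjc mulN1r.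
- by exists K1 => // x xK; rewrite psi0 ?conjc0.
Qed.

Lemma test_function_cpartial Omega i psi : test_function Omega psi ->
  test_function Omega (cpartial i psi).
Proof.
move=> [r1 i1 [K1 [cK1 K1O] psi0]]; split; [exact: smooth_partial..|].
exists K1 => // x xK.
(* K1 is closed, so psi vanishes on a neighbourhood of x. *)
have near0 : \near x, psi x = 0.
  have : nbhs x (~` K1).
    by apply: open_nbhs_nbhs; split; [exact: closed_openC (compact_closed_Rn cK1)|exact: xK].
  by apply: filterS => y; exact: psi0.
by rewrite /cpartial /partial (@near_eq_derive _ _ _ _ (cst 0));
  [rewrite derive_cst (@near_eq_derive _ _ _ _ (cst 0)) ?derive_cst//|];
  apply: filterS near0 => y /= ->.
Qed.

Lemma cpartialD Omega i psi chi : test_function Omega psi ->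
  test_function Omega chi ->
  cpartial i (fun x => psi x + chi x) = (fun x => cpartial i psi x + cpartial i chi x).
Proof.
move=> [r1 i1 _] [r2 i2 _]; apply/funext => x; apply: complexP; rewrite ?ReImE /=.
  by under [X in partial _ X]eq_fun do rewrite Re_addc; rewrite partialD.
by under [X in partial _ X]eq_fun do rewrite Im_addc; rewrite partialD.
Qed.

Lemma cpartialZ Omega i (z : R[i]) psi : test_function Omega psi ->
  cpartial i (fun x => z * psi x) = (fun x => z * cpartial i psi x).
Proof.
move=> [r1 i1 _]; apply/funext => x; apply: complexP; rewrite ?ReImE /=.
  under [X in partial _ X]eq_fun do rewrite Re_mulc -mulNr.
  by rewrite (partialD _ (smoothZ _ r1) (smoothZ _ i1)) (partialZ _ _ r1) (partialZ _ _ i1) mulNr.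
under [X in partial _ X]eq_fun do rewrite Im_mulc.
by rewrite (partialD _ (smoothZ _ i1) (smoothZ _ r1)) (partialZ _ _ r1) (partialZ _ _ i1).
Qed.

Lemma cpartialJ Omega i psi : test_function Omega psi ->
  cpartial i (fun x => conjc (psi x)) = (fun x => conjc (cpartial i psi x)).
Proof.
move=> [r1 i1 _]; apply/funext => x; apply: complexP; rewrite ?ReImE /=.
  by under [X in partial _ X]eq_fun do rewrite Re_conjc.
under [X in partial _ X]eq_fun do rewrite Im_conjc -mulN1r.
by rewrite partialZ// mulN1r.
Qed.

Lemma continuous_compact_support_bounded h (K : set E) : continuous h ->
  compact K -> (forall x, ~ K x -> h x = 0) -> exists M, forall x, h x ^+ 2 <= M ^+ 2.
Proof.
move=> ch cK h0.
have [M [_ hM]] : bounded_set (h @` K).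
  by apply/compact_bounded/continuous_compact => //; exact: continuous_subspaceT.
have M1 : 0 <= `|M| + 1 by rewrite addr_ge0.
exists (`|M| + 1) => x; have [Kx|/h0->] := pselect (K x); last first.
  by rewrite expr0n sqr_ge0.
rewrite -[h x ^+ 2]real_normK ?num_real// ler_sqr ?nnegrE//.
by apply: (hM _ _ (h x)); [rewrite (le_lt_trans (ler_norm _))// ltrDl|exists x].
Qed.

(** A test function is bounded and Omega has finite measure. *)
Lemma test_function_L2 Omega psi : measurable (Omega : set (lebesgue_space R d)) ->
  bounded_set Omega -> test_function Omega psi -> L2 Omega psi.
Proof.
move=> mO bO [sr si [K [cK KO] psi0]].
have [M1 HM1] := continuous_compact_support_bounded (smooth_continuous sr (s:=[::])) cK
  (fun x xK => congr1 (@complex.Re R) (psi0 x xK)).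
have [M2 HM2] := continuous_compact_support_bounded (smooth_continuous si (s:=[::])) cK
  (fun x xK => congr1 (@complex.Im R) (psi0 x xK)).
apply: (le_L2 mO (g := fun=> M1 ^+ 2 + M2 ^+ 2)).
- exact: (continuous_measurable_Rn (smooth_continuous sr (s:=[::]))).
- exact: (continuous_measurable_Rn (smooth_continuous si (s:=[::]))).
- apply: measurable_bounded_integrable => //; first exact: bounded_finite_measure.
  exact: bounded_cst.
- by move=> x; apply: lerD; [exact: HM1|exact: HM2].
Qed.

End test_functions.

Section bounded_multiplication.
Variables (R : realType) (d : nat).
Local Notation E := 'rV[R]_d.+1.

Lemma L2_Linfty (Omega : set E) (V : E -> R) (u : E -> R[i]) :
  measurable (Omega : set (lebesgue_space R d)) ->
  Linfty Omega V -> L2 Omega u -> L2 Omega (fun x => (V x)%:C * u x).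
Proof.
move=> mO [mV [M HM]] L2u; have [mr mi uoo] := L2E L2u.
have mr' : measurable_fun (Omega : set (lebesgue_space R d))
    (fun x : lebesgue_space R d => complex.Re ((V x)%:C * u x)).
  by under eq_fun do rewrite Re_mulc /= mul0r subr0; exact: measurable_funM.
have mi' : measurable_fun (Omega : set (lebesgue_space R d))
    (fun x : lebesgue_space R d => complex.Im ((V x)%:C * u x)).
  by under eq_fun do rewrite Im_mulc /= mul0r addr0; exact: measurable_funM.
split => //.
have L2Mu := L2Z mO M%:C L2u; have [mMr mMi Mu] := L2E L2Mu.
apply: le_lt_trans Mu; apply: (ae_ge0_le_integral mO).
- by move=> x _; rewrite lee_fin sqnorm_ge0.
- by apply/measurable_EFinP; exact: measurable_sqnorm.
- by move=> x _; rewrite lee_fin sqnorm_ge0.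
- by apply/measurable_EFinP; exact: measurable_sqnorm.
case: HM => N [mN N0 HM]; exists N; split => //.
apply: subset_trans HM => x; apply: contra_not => /= HM Ox.
rewrite lee_fin !sqnormM !sqnormR ler_wpM2r ?sqnorm_ge0//.
have := HM Ox => VM; have M0 := le_trans (normr_ge0 _) VM.
by rewrite -[V x ^+ 2]real_normK ?num_real// ler_sqr ?nnegrE.
Qed.

End bounded_multiplication.

Section dirichlet_schrodinger.
Variables (R : realType) (d : nat).
Local Notation E := 'rV[R]_d.+1.
Variables (Omega : set E) (V : E -> R).
Hypothesis mO : measurable (Omega : set (lebesgue_space R d)).
Hypothesis Omega_bounded : bounded_set Omega.
Hypothesis V_Linfty : Linfty Omega V.
Implicit Types (u v f : E -> R[i]) (g k : 'I_d.+1 -> E -> R[i]).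
Local Opaque L2 cintegrable.

Let testL2 psi : test_function Omega psi -> L2 Omega psi.
Proof. exact: test_function_L2. Qed.

Let test_cpartialL2 i psi : test_function Omega psi -> L2 Omega (cpartial i psi).
Proof. by move=> tpsi; exact: testL2 (test_function_cpartial i tpsi). Qed.

(** The second derivatives of a test function are again test functions, hence
    square-integrable, which allows splitting the integral. *)
Lemma schrodinger_integral u psi : L2 Omega u -> test_function Omega psi ->
  cintegral Omega (fun x => u x * laplacian psi x - (V x)%:C * u x * psi x) =
  \sum_(i < d.+1) cintegral Omega (fun x => u x * cpartial i (cpartial i psi) x) -
  cintegral Omega (fun x => (V x)%:C * u x * psi x).
Proof.
move=> L2u tpsi.
have di i : cintegrable Omega (fun x => u x * cpartial i (cpartial i psi) x).
  by apply: (L2_cintegrableM mO L2u); apply/test_cpartialL2/test_function_cpartial.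
have Vi : cintegrable Omega (fun x => (V x)%:C * u x * psi x).
  exact: (L2_cintegrableM mO (L2_Linfty mO V_Linfty L2u) (testL2 tpsi)).
rewrite -(cintegral_sum mO _ di) -(cintegralN mO Vi).
rewrite -(cintegralD mO (cintegrable_sum mO _ di) (cintegrableN mO Vi)).
by congr cintegral; apply/funext => x; rewrite /laplacian mulr_sumr.
Qed.

(** Testing against the conjugate of psi turns the bilinear pairing into the
    inner product, and the weak gradient takes over one of the two derivatives. *)
Lemma schrodinger_weak_form u g f psi : L2 Omega u -> weak_gradient Omega u g ->
  L2 Omega f -> schrodinger_eq Omega V u f -> test_function Omega psi ->
  L2inner Omega f psi =
  - (\sum_(i < d.+1) L2inner Omega (g i) (cpartial i psi) +
     L2inner Omega (fun x => (V x)%:C * u x) psi).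
Proof.
move=> L2u wg L2f eqf tpsi; have tJ := test_functionJ tpsi.
rewrite /L2inner -(eqf _ tJ) schrodinger_integral// opprD -sumrN.
congr (_ + _); apply: eq_bigr => i _.
rewrite ((wg i).2 _ (test_function_cpartial i tJ)).
by rewrite (cpartialJ i tpsi).
Qed.

(** Both sides of the weak form depend on psi continuously in the H^1 norm, for
    which v is a limit of test functions. *)
Lemma schrodinger_energy_form u g f v k : L2 Omega u -> weak_gradient Omega u g ->
  L2 Omega f -> schrodinger_eq Omega V u f ->
  L2 Omega v -> weak_gradient Omega v k ->
  (exists psi : nat -> E -> R[i],
    [/\ forall n, test_function Omega (psi n),
        sqL2norm Omega (fun x => v x - psi n x) @[n --> \oo] --> 0%E &
        forall i, sqL2norm Omega (fun x => k i x - cpartial i (psi n) x)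
          @[n --> \oo] --> 0%E]) ->
  L2inner Omega f v =
  - (\sum_(i < d.+1) L2inner Omega (g i) (k i) +
     L2inner Omega (fun x => (V x)%:C * u x) v).
Proof.
move=> L2u wg L2f eqf L2v wk [psi [tpsi psi_v dpsi_k]].
have L2Vu := L2_Linfty mO V_Linfty L2u.
pose D := L2inner Omega f v + (\sum_(i < d.+1) L2inner Omega (g i) (k i) +
  L2inner Omega (fun x => (V x)%:C * u x) v).
suff : D = 0 by move/eqP; rewrite addr_eq0 => /eqP.
pose r n := L2inner Omega f (fun x => v x - psi n x) +
  (\sum_(i < d.+1) L2inner Omega (g i) (fun x => k i x - cpartial i (psi n) x) +
   L2inner Omega (fun x => (V x)%:C * u x) (fun x => v x - psi n x)).
have rD n : r n = D.
  have L2psi := testL2 (tpsi n).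
  rewrite /r (L2innerBr mO L2v L2psi L2f) (L2innerBr mO L2v L2psi L2Vu).
  have -> : \sum_(i < d.+1) L2inner Omega (g i) (fun x => k i x - cpartial i (psi n) x)
    = \sum_(i < d.+1) (L2inner Omega (g i) (k i) - L2inner Omega (g i) (cpartial i (psi n))).
    apply: eq_bigr => i _.
    by rewrite (L2innerBr mO (wk i).1 (test_cpartialL2 i (tpsi n)) (wg i).1).
  rewrite (schrodinger_weak_form L2u wg L2f eqf (tpsi n)) sumrB /D; ring.
have L2v_psi n : L2 Omega (fun x => v x - psi n x) by exact: (L2B mO L2v (testL2 (tpsi n))).
have : cvanish \oo r.
  apply: cvanishD; first exact: (L2inner_cvanish mO L2f L2v_psi psi_v).
  apply: cvanishD; last exact: (L2inner_cvanish mO L2Vu L2v_psi psi_v).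
  apply: cvanish_sum => i; apply: (L2inner_cvanish mO (wg i).1 _ (dpsi_k i)) => n.
  exact: (L2B mO (wk i).1 (test_cpartialL2 i (tpsi n))).
rewrite /cvanish (_ : (fun n => sqnorm (r n)) = (fun=> sqnorm D)); last first.
  by apply/funext => n; rewrite rD.
move=> D0; apply/eqP; rewrite -sqnorm_eq0; apply/eqP.
exact: (cvg_unique _ (cvg_cst (sqnorm D)) D0).
Qed.

(** The energy form is Hermitian because V is real, so Delta - V is symmetric
    on H^1_0. *)
Lemma schrodinger_symmetric u v f (g : E -> R[i]) : H10 Omega u -> H10 Omega v ->
  L2 Omega f -> L2 Omega g ->
  schrodinger_eq Omega V u f -> schrodinger_eq Omega V v g ->
  L2inner Omega f v = L2inner Omega u g.
Proof.
move=> [L2u [gu wu apu]] [L2v [gv wv apv]] L2f L2g eqf eqg.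
rewrite (schrodinger_energy_form L2u wu L2f eqf L2v wv apv).
rewrite -(L2innerJ mO L2g L2u) (schrodinger_energy_form L2v wv L2g eqg L2u wu apu).
rewrite rmorphN rmorphD rmorph_sum; congr (- (_ + _)).
  by apply: eq_bigr => i _; rewrite -(L2innerJ mO (wv i).1 (wu i).1).
rewrite -(L2innerJ mO L2v (L2_Linfty mO V_Linfty L2u)).
congr (conjc _); congr cintegral; apply/funext => x.
by rewrite conjcM conjc_real; ring.
Qed.

(** Symmetry moves the operator onto the eigenfunction; this makes the
    Schrodinger equation diagonal in the eigenbasis. *)
Lemma eigenfunction_component u f (l : R) phi : H10 Omega u -> L2 Omega f ->
  schrodinger_eq Omega V u f -> eigenfunction Omega V l phi ->
  L2inner Omega f phi = - l%:C * L2inner Omega u phi.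
Proof.
move=> Hu L2f equ [[Hphi _] eqphi]; have L2phi := Hphi.1.
rewrite (schrodinger_symmetric Hu Hphi L2f (L2Z mO (- l%:C) L2phi) equ eqphi).
rewrite (L2innerZr mO _ L2phi Hu.1); congr (_ * _).
by apply: complexP; rewrite !ReImE //= !oppr0.
Qed.

Lemma weak_gradientD u v g k : L2 Omega u -> L2 Omega v ->
  weak_gradient Omega u g -> weak_gradient Omega v k ->
  weak_gradient Omega (fun x => u x + v x) (fun i x => g i x + k i x).
Proof.
move=> L2u L2v wg wk i; split; first exact: (L2D mO (wg i).1 (wk i).1).
move=> psi tpsi; have L2d := test_cpartialL2 i tpsi; have L2psi := testL2 tpsi.
under [X in cintegral _ X]eq_fun do rewrite mulrDl.
under [X in - cintegral _ X]eq_fun do rewrite mulrDl.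
rewrite (cintegralD mO (L2_cintegrableM mO L2u L2d) (L2_cintegrableM mO L2v L2d)).
rewrite (cintegralD mO (L2_cintegrableM mO (wg i).1 L2psi)
                       (L2_cintegrableM mO (wk i).1 L2psi)).
by rewrite opprD ((wg i).2 _ tpsi) ((wk i).2 _ tpsi).
Qed.

Lemma weak_gradientZ z u g : L2 Omega u -> weak_gradient Omega u g ->
  weak_gradient Omega (fun x => z * u x) (fun i x => z * g i x).
Proof.
move=> L2u wg i; split; first exact: (L2Z mO z (wg i).1).
move=> psi tpsi; have L2d := test_cpartialL2 i tpsi; have L2psi := testL2 tpsi.
under [X in cintegral _ X]eq_fun do rewrite -mulrA.
under [X in - cintegral _ X]eq_fun do rewrite -mulrA.
rewrite (cintegralZ mO z (L2_cintegrableM mO L2u L2d)).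
rewrite (cintegralZ mO z (L2_cintegrableM mO (wg i).1 L2psi)).
by rewrite ((wg i).2 _ tpsi) mulrN.
Qed.

Lemma sqL2norm_cvg0D (f g : nat -> E -> R[i]) : (forall n, L2 Omega (f n)) ->
  (forall n, L2 Omega (g n)) -> sqL2norm Omega (f n) @[n --> \oo] --> 0%E ->
  sqL2norm Omega (g n) @[n --> \oo] --> 0%E ->
  sqL2norm Omega (fun x => f n x + g n x) @[n --> \oo] --> 0%E.
Proof.
move=> L2f L2g /(sqL2norm_cvg0P mO L2f) f0 /(sqL2norm_cvg0P mO L2g) g0.
apply/(sqL2norm_cvg0P mO (fun n => L2D mO (L2f n) (L2g n))).
apply: (@squeeze_cvgr _ _ _ _ (fun=> 0) (fun n => 2 * L2sq Omega (g n) + 2 * L2sq Omega (f n))).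
- apply: nearW => n; rewrite L2sq_ge0 /=.
  have := L2sq_young mO ltr01 (L2D mO (L2f n) (L2g n)) (L2g n).
  rewrite (_ : (fun x => f n x + g n x - g n x) = f n) ?invr1//.
  by apply/funext => x; rewrite addrK.
- exact: cvg_cst.
- rewrite -[0](addr0 0) -{1}(mulr0 2) -{2}(mulr0 2).
  by apply: cvgD; apply: cvgMr.
Qed.

Lemma sqL2norm_cvg0Z z (f : nat -> E -> R[i]) : (forall n, L2 Omega (f n)) ->
  sqL2norm Omega (f n) @[n --> \oo] --> 0%E ->
  sqL2norm Omega (fun x => z * f n x) @[n --> \oo] --> 0%E.
Proof.
move=> L2f /(sqL2norm_cvg0P mO L2f) f0.
apply/(sqL2norm_cvg0P mO (fun n => L2Z mO z (L2f n))).
rewrite -(mulr0 (sqnorm z)) (_ : (fun n => _) = (fun n => sqnorm z * L2sq Omega (f n))).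
  exact: cvgMr.
by apply/funext => n; rewrite (L2sqZ mO _ (L2f n)).
Qed.

Lemma H10D u v : H10 Omega u -> H10 Omega v -> H10 Omega (fun x => u x + v x).
Proof.
move=> [L2u [g wg [p [tp pu dp]]]] [L2v [k wk [q [tq qv dq]]]].
split; first exact: (L2D mO L2u L2v).
exists (fun i x => g i x + k i x); first exact: weak_gradientD.
exists (fun n x => p n x + q n x); split => [n||i].
- exact: test_functionD.
- rewrite (_ : (fun n => _) = (fun n =>
    sqL2norm Omega (fun x => (u x - p n x) + (v x - q n x)))); last first.
    by apply/funext => n; congr sqL2norm; apply/funext => x; ring.
  apply: (sqL2norm_cvg0D _ _ pu qv) => n.
    exact: (L2B mO L2u (testL2 (tp n))).
  exact: (L2B mO L2v (testL2 (tq n))).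
- rewrite (_ : (fun n => _) = (fun n => sqL2norm Omega (fun x =>
    (g i x - cpartial i (p n) x) + (k i x - cpartial i (q n) x)))); last first.
    apply/funext => n; congr sqL2norm; apply/funext => x.
    by rewrite (cpartialD i (tp n) (tq n)); ring.
  apply: (sqL2norm_cvg0D _ _ (dp i) (dq i)) => n.
    exact: (L2B mO (wg i).1 (test_cpartialL2 i (tp n))).
  exact: (L2B mO (wk i).1 (test_cpartialL2 i (tq n))).
Qed.

Lemma H10Z z u : H10 Omega u -> H10 Omega (fun x => z * u x).
Proof.
move=> [L2u [g wg [p [tp pu dp]]]].
split; first exact: (L2Z mO z L2u).
exists (fun i x => z * g i x); first exact: weak_gradientZ.
exists (fun n x => z * p n x); split => [n||i].
- exact: test_functionZ.
- rewrite (_ : (fun n => _) = (fun n =>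
    sqL2norm Omega (fun x => z * (u x - p n x)))); last first.
    by apply/funext => n; congr sqL2norm; apply/funext => x; ring.
  apply: (sqL2norm_cvg0Z z _ pu) => n.
  exact: (L2B mO L2u (testL2 (tp n))).
- rewrite (_ : (fun n => _) = (fun n => sqL2norm Omega (fun x =>
    z * (g i x - cpartial i (p n) x)))); last first.
    apply/funext => n; congr sqL2norm; apply/funext => x.
    by rewrite (cpartialZ i z (tp n)); ring.
  apply: (sqL2norm_cvg0Z z _ (dp i)) => n.
  exact: (L2B mO (wg i).1 (test_cpartialL2 i (tp n))).
Qed.

Lemma H1D u v : H1 Omega u -> H1 Omega v -> H1 Omega (fun x => u x + v x).
Proof.
move=> [L2u [g wg]] [L2v [k wk]]; split; first exact: (L2D mO L2u L2v).
by exists (fun i x => g i x + k i x); exact: weak_gradientD.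
Qed.

Lemma H1Z z u : H1 Omega u -> H1 Omega (fun x => z * u x).
Proof.
move=> [L2u [g wg]]; split; first exact: (L2Z mO z L2u).
by exists (fun i x => z * g i x); exact: weak_gradientZ.
Qed.

Lemma operator_domainD u v : operator_domain Omega u -> operator_domain Omega v ->
  operator_domain Omega (fun x => u x + v x).
Proof.
move=> [Hu [L2u [g wg Hg]]] [Hv [L2v [k wk Hk]]]; split; first exact: H10D.
split; first exact: (L2D mO L2u L2v).
by exists (fun i x => g i x + k i x) => [|i]; [exact: weak_gradientD|exact: H1D].
Qed.

Lemma operator_domainZ z u : operator_domain Omega u ->
  operator_domain Omega (fun x => z * u x).
Proof.
move=> [Hu [L2u [g wg Hg]]]; split; first exact: H10Z.
split; first exact: (L2Z mO z L2u).
by exists (fun i x => z * g i x) => [|i]; [exact: weak_gradientZ|exact: H1Z].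
Qed.

Lemma schrodinger_eqD u v f (g : E -> R[i]) : L2 Omega u -> L2 Omega v -> L2 Omega f -> L2 Omega g ->
  schrodinger_eq Omega V u f -> schrodinger_eq Omega V v g ->
  schrodinger_eq Omega V (fun x => u x + v x) (fun x => f x + g x).
Proof.
move=> L2u L2v L2f L2g eqf eqg psi tpsi; have L2psi := testL2 tpsi.
have L2Vu := L2_Linfty mO V_Linfty L2u; have L2Vv := L2_Linfty mO V_Linfty L2v.
under [X in _ = cintegral _ X]eq_fun do rewrite mulrDl.
rewrite (cintegralD mO (L2_cintegrableM mO L2f L2psi) (L2_cintegrableM mO L2g L2psi)).
rewrite -(eqf _ tpsi) -(eqg _ tpsi).
rewrite (schrodinger_integral (L2D mO L2u L2v) tpsi) (schrodinger_integral L2u tpsi) (schrodinger_integral L2v tpsi).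
have -> : cintegral Omega (fun x => (V x)%:C * (u x + v x) * psi x) =
    cintegral Omega (fun x => (V x)%:C * u x * psi x) +
    cintegral Omega (fun x => (V x)%:C * v x * psi x).
  rewrite -(cintegralD mO (L2_cintegrableM mO L2Vu L2psi) (L2_cintegrableM mO L2Vv L2psi)).
  by congr cintegral; apply/funext => x; ring.
rewrite opprD addrACA -big_split/=; congr (_ + _); apply: eq_bigr => i _.
have L2d := test_cpartialL2 i (test_function_cpartial i tpsi).
rewrite -(cintegralD mO (L2_cintegrableM mO L2u L2d) (L2_cintegrableM mO L2v L2d)).
by congr cintegral; apply/funext => x; ring.
Qed.

Lemma schrodinger_eqZ z u f : L2 Omega u -> L2 Omega f ->
  schrodinger_eq Omega V u f ->
  schrodinger_eq Omega V (fun x => z * u x) (fun x => z * f x).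
Proof.
move=> L2u L2f eqf psi tpsi; have L2psi := testL2 tpsi.
have L2Vu := L2_Linfty mO V_Linfty L2u.
have -> : cintegral Omega (fun x => z * f x * psi x) =
    z * cintegral Omega (fun x => f x * psi x).
  rewrite -(cintegralZ mO z (L2_cintegrableM mO L2f L2psi)).
  by congr cintegral; apply/funext => x; ring.
rewrite -(eqf _ tpsi) (schrodinger_integral (L2Z mO z L2u) tpsi) (schrodinger_integral L2u tpsi).
rewrite mulrBr mulr_sumr; congr (_ - _).
  apply: eq_bigr => i _.
  have L2d := test_cpartialL2 i (test_function_cpartial i tpsi).
  rewrite -(cintegralZ mO z (L2_cintegrableM mO L2u L2d)).
  by congr cintegral; apply/funext => x; ring.
rewrite -(cintegralZ mO z (L2_cintegrableM mO L2Vu L2psi)).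
by congr cintegral; apply/funext => x; ring.
Qed.

Lemma operator_domain_sum (s : seq nat) (z : nat -> R[i]) (phi : nat -> E -> R[i]) :
  (forall j, operator_domain Omega (phi j)) ->
  operator_domain Omega (fun x => \sum_(j <- s) z j * phi j x).
Proof.
move=> Dphi; elim: s => [|j s IHs].
  rewrite (_ : (fun x => _) = (fun x => 0 * phi 0%N x)).
    exact: operator_domainZ.
  by apply/funext => x; rewrite big_nil mul0r.
rewrite (_ : (fun x => _) = (fun x => z j * phi j x + \sum_(j <- s) z j * phi j x)).
  exact: (operator_domainD (operator_domainZ (z j) (Dphi j)) IHs).
by apply/funext => x; rewrite big_cons.
Qed.

Lemma schrodinger_eq_sum (s : seq nat) (z : nat -> R[i]) (u f : nat -> E -> R[i]) :
  (forall j, L2 Omega (u j)) -> (forall j, L2 Omega (f j)) ->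
  (forall j, schrodinger_eq Omega V (u j) (f j)) ->
  schrodinger_eq Omega V (fun x => \sum_(j <- s) z j * u j x)
    (fun x => \sum_(j <- s) z j * f j x).
Proof.
move=> L2u L2f equ; have L2z h j : (forall i, L2 Omega (h i)) ->
  L2 Omega (fun x => z j * h j x) by move=> L2h; exact: (L2Z mO (z j) (L2h j)).
elim: s => [|j s IHs].
  rewrite (_ : (fun x => _) = (fun x => 0 * u 0%N x)); last first.
    by apply/funext => x; rewrite big_nil mul0r.
  rewrite (_ : (fun x => \sum_(j <- _) z j * f j x) = (fun x => 0 * f 0%N x)); last first.
    by apply/funext => x; rewrite big_nil mul0r.
  by apply: schrodinger_eqZ.
rewrite (_ : (fun x => _) = (fun x => z j * u j x + \sum_(j <- s) z j * u j x)); last first.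
  by apply/funext => x; rewrite big_cons.
rewrite (_ : (fun x => \sum_(i <- j :: s) z i * f i x) =
    (fun x => z j * f j x + \sum_(j <- s) z j * f j x)); last first.
  by apply/funext => x; rewrite big_cons.
apply: (schrodinger_eqD (L2z u j L2u) (L2_sum mO s (fun i => L2z u i L2u))
  (L2z f j L2f) (L2_sum mO s (fun i => L2z f i L2f)) _ IHs).
exact: schrodinger_eqZ.
Qed.

End dirichlet_schrodinger.

(** * Time means of oscillations *)

Section time_mean.
Variable R : realType.
Local Notation Re := complex.Re.
Local Notation Im := complex.Im.
Local Notation leb := (@lebesgue_measure R).
Implicit Types (f g : R -> R) (T w : R).

Definition expi (x : R) : R[i] := cos x +i* sin x.

Lemma expi0 : expi 0 = 1.
Proof. by rewrite /expi cos0 sin0. Qed.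

Lemma expiD x y : expi (x + y) = expi x * expi y.
Proof. by apply: complexP; rewrite !ReImE /expi/= ?sinD ?cosD; ring. Qed.

Lemma expiN x : expi (- x) = conjc (expi x).
Proof. by rewrite /expi/= sinN cosN. Qed.

Lemma sqnorm_expi x : sqnorm (expi x) = 1.
Proof. exact: cos2Dsin2. Qed.

Definition time_mean f T : R := T^-1 * \int[leb]_(t in `[0, T]) f t.

Lemma continuous_itv_integrable f a b : continuous f ->
  leb.-integrable `[a, b] (EFin \o f).
Proof.
move=> cf; apply: continuous_compact_integrable; first exact: segment_compact.
exact: continuous_subspaceT.
Qed.

Lemma time_meanD f g T : continuous f -> continuous g ->
  time_mean (fun t => f t + g t) T = time_mean f T + time_mean g T.
Proof.
move=> cf cg; rewrite /time_mean RintegralD//; [by rewrite mulrDr|..];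
  exact: continuous_itv_integrable.
Qed.

Lemma time_mean_cst c T : 0 < T -> time_mean (fun=> c) T = c.
Proof.
move=> T0; rewrite /time_mean Rintegral_cst//= lebesgue_measure_itv/= lte_fin T0.
by rewrite -EFinB/= subr0; field; rewrite gt_eqF.
Qed.

Lemma cvg_sumr (J : Type) (F : set_system J) {FF : Filter F} I (s : seq I)
    (f : I -> J -> R) (l : I -> R) : (forall i, f i t @[t --> F] --> l i) ->
  \sum_(i <- s) f i t @[t --> F] --> \sum_(i <- s) l i.
Proof.
move=> fl; elim: s => [|i s IHs].
  by rewrite big_nil; under eq_fun do rewrite big_nil; exact: cvg_cst.
by rewrite big_cons; under eq_fun do rewrite big_cons; exact: cvgD (fl i) IHs.
Qed.

Lemma continuous_sum I (s : seq I) (F : I -> R -> R) : (forall i, continuous (F i)) ->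
  continuous (fun t => \sum_(i <- s) F i t).
Proof. by move=> cF t; apply: cvg_sumr => i; exact: cF. Qed.

Lemma time_mean_sum I (s : seq I) (F : I -> R -> R) T : (forall i, continuous (F i)) ->
  time_mean (fun t => \sum_(i <- s) F i t) T = \sum_(i <- s) time_mean (F i) T.
Proof.
move=> cF; elim: s => [|i s IHs].
  rewrite big_nil /time_mean; under eq_Rintegral do rewrite big_nil.
  by rewrite Rintegral_cst//= mul0r mulr0.
rewrite big_cons -IHs -time_meanD//; last exact: continuous_sum.
by congr (_ * _); apply: eq_Rintegral => t _; rewrite big_cons.
Qed.

Lemma time_mean_le f g (e : R) T : 0 < T -> continuous f -> continuous g ->
  (forall t, f t <= g t + e) -> time_mean f T <= time_mean g T + e.
Proof.
move=> T0 cf cg fg; rewrite -[X in _ + X](time_mean_cst e T0).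
have ce : continuous (fun _ : R => e) by move=> t; exact: cvg_cst.
rewrite -time_meanD// /time_mean ler_pM2l ?invr_gt0//.
apply: le_Rintegral => //; first exact: continuous_itv_integrable.
by apply: continuous_itv_integrable => t; apply: continuousD; [exact: cg|exact: ce].
Qed.

Lemma inv_cvg_pinfty : T^-1 @[T --> +oo] --> (0 : R).
Proof.
apply/(@gtr0_cvgV0 R R (+oo)); last exact: cvg_id.
exact: nbhs_pinfty_gt.
Qed.

(** The integral over [0, T] is F T - F 0, which stays bounded as T grows. *)
Lemma time_mean_bounded_primitive f F (B : R) : continuous f ->
  (forall t, is_derive t (1 : R) F (f t)) -> (forall t, `|F t| <= B) ->
  time_mean f T @[T --> +oo] --> 0.
Proof.
move=> cf dF FB.
have integralE T : 0 < T -> \int[leb]_(t in `[0, T]) f t = F T - F 0.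
  move=> T0; rewrite /Rintegral (@continuous_FTC2 _ f F)//.
  - exact: continuous_subspaceT.
  - have cF t : {for t, continuous F} by apply: differentiable_continuous; apply/derivable1_diffP.
    split => [t _||]; first by [].
    + by apply: cvg_at_right_filter; exact: cF.
    + by apply: cvg_at_left_filter; exact: cF.
  - by move=> t _; rewrite derive1E derive_val.
apply: norm_cvg0; apply: (@squeeze_cvgr _ _ _ _ (fun=> 0) (fun T => (2 * B) * T^-1)).
- near=> T; rewrite normr_ge0 /=.
  have T0 : 0 < T by near: T; exact: nbhs_pinfty_gt.
  rewrite /time_mean integralE// normrM mulrC (gtr0_norm (x := T^-1)) ?invr_gt0//.
  rewrite ler_pM2r ?invr_gt0// (le_trans (ler_normB _ _))// mulr_natl mulr2n.
  by apply: lerD; exact: FB.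
- exact: cvg_cst.
- rewrite -(mulr0 (2 * B)); apply: cvgMr; exact: inv_cvg_pinfty.
Unshelve. all: by end_near. Qed.

Lemma continuous_oscillation (w : R) (H : R[i]) :
  continuous (fun t => Re (expi (w * t) * H)).
Proof.
rewrite (_ : (fun t => _) = (fun t => cos (w * t) * Re H - sin (w * t) * Im H)); last first.
  by apply/funext => t; rewrite Re_mulc.
move=> t.
have cw : {for t, continuous (fun t => w * t)} by apply: cvgMr; exact: cvg_id.
apply: cvgB; apply: cvgMl; apply: (continuous_comp cw).
  exact: continuous_cos.
exact: continuous_sin.
Qed.

Lemma time_mean_oscillation (w : R) (H : R[i]) :
  time_mean (fun t => Re (expi (w * t) * H)) T @[T --> +oo] -->
  (if w == 0 then Re H else 0).
Proof.
have [->|w0] := eqVneq w 0.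
  apply: cvg_near_cst; near=> T.
  rewrite -[RHS](@time_mean_cst _ T); last by near: T; exact: nbhs_pinfty_gt.
  by congr (_ * _); apply: eq_Rintegral => t _; rewrite mul0r expi0 mul1r.
(* The primitive is the real part of expi (w t) H / (i w). *)
apply: (@time_mean_bounded_primitive _
   (fun t => (sin (w * t) * Re H + cos (w * t) * Im H) / w)
   ((`|Re H| + `|Im H|) / `|w|)).
- exact: continuous_oscillation.
- move=> t; apply: is_derive_eq; rewrite Re_mulc /=.
  by rewrite /GRing.scale/=; field.
- move=> t; rewrite normrM normfV ler_wpM2r ?invr_ge0//.
  rewrite (le_trans (ler_normD _ _))// !normrM lerD//.
    by rewrite ler_piMl// sin_max.
  by rewrite ler_piMl// cos_max.
Unshelve. all: by end_near. Qed.

(** An approximation that is uniform over all times survives averaging, so the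
    two limits can be exchanged. *)
Lemma time_mean_cvg_approx f (g : nat -> R -> R) (e q : nat -> R) (Q : R) :
  continuous f -> (forall n, continuous (g n)) ->
  (forall n t, `|f t - g n t| <= e n) -> (forall n, `|q n - Q| <= e n) ->
  (forall n, time_mean (g n) T @[T --> +oo] --> q n) ->
  e n @[n --> \oo] --> 0 -> time_mean f T @[T --> +oo] --> Q.
Proof.
move=> cf cg fg qQ gq e0; apply/cvgrPdist_le => d d0.
have d3 : 0 < d / 3 by rewrite divr_gt0.
have [n _ /(_ n (leqnn n))] : \forall n \near \oo, `|0 - e n| <= d / 3.
  by move/cvgrPdist_le: e0; exact.
rewrite sub0r normrN => /(le_trans (ler_norm _)) en.
have /cvgrPdist_le/(_ _ d3) gqn := gq n.
near=> T; have T0 : 0 < T by near: T; exact: nbhs_pinfty_gt.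
have h1 : `|q n - time_mean (g n) T| <= d / 3 by near: T.
have h2 := qQ n.
have h3 : time_mean f T <= time_mean (g n) T + e n.
  apply: time_mean_le => // t; rewrite addrC -lerBlDr.
  exact: le_trans (ler_norm _) (fg n t).
have h4 : time_mean (g n) T <= time_mean f T + e n.
  apply: time_mean_le => // t; rewrite addrC -lerBlDr.
  by rewrite (le_trans (ler_norm _))// distrC.
move: h1 h2; rewrite !ler_norml; lra.
Unshelve. all: by end_near. Qed.

(** Choosing a = sqrt e balances the two error terms a M and e / a. *)
Lemma young_dist (x y M e : R) : 0 < e -> x <= M -> y <= M ->
  (forall a, 0 < a -> x <= (1 + a) * y + (1 + a^-1) * e) ->
  (forall a, 0 < a -> y <= (1 + a) * x + (1 + a^-1) * e) ->
  `|x - y| <= Num.sqrt e * (M + 1) + e.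
Proof.
move=> e0 xM yM xy yx; have s0 : 0 < Num.sqrt e by rewrite sqrtr_gt0.
have se : (Num.sqrt e)^-1 * e = Num.sqrt e.
  by rewrite -[X in _ * X]sqr_sqrtr ?ltW// expr2 mulKf ?gt_eqF.
have := xy _ s0; have := yx _ s0; rewrite !mulrDl !mul1r se.
have := ler_wpM2l (ltW s0) xM; have := ler_wpM2l (ltW s0) yM.
rewrite ler_norml mulrDr mulr1; lra.
Qed.

Lemma sqrt_bound_cvg0 (M : R) (e : nat -> R) : e n @[n --> \oo] --> 0 ->
  Num.sqrt (e n) * (M + 1) + e n @[n --> \oo] --> 0.
Proof.
move=> e0; rewrite [X in _ --> X](_ : 0 = 0 * (M + 1) + 0); last by rewrite mul0r addr0.
apply: cvgD => //; apply: cvgMl; rewrite -(sqrtr0 R).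
by apply: (cvg_comp _ _ e0); exact: sqrt_continuous.
Qed.

End time_mean.

(** * The spectral functional *)

Section square_summable.
Variable R : realType.
Implicit Types c : nat -> R[i].

Definition energy c : R := fine (\sum_(0 <= k <oo) (sqnorm (c k))%:E)%E.

Definition truncate N c : nat -> R[i] := fun k => if (k < N)%N then c k else 0.

Lemma energyE c : ell2 c -> (\sum_(0 <= k <oo) (sqnorm (c k))%:E)%E = (energy c)%:E.
Proof.
move=> c2; rewrite /energy fineK// ge0_fin_numE//.
by apply: nneseries_ge0 => k _ _; rewrite lee_fin sqnorm_ge0.
Qed.

Lemma energy_ge0 c : 0 <= energy c.
Proof.
by apply: fine_ge0; apply: nneseries_ge0 => k _ _; rewrite lee_fin sqnorm_ge0.
Qed.

Lemma energy_split N c : ell2 c -> ((energy c)%:E =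
  (\sum_(0 <= k < N) sqnorm (c k))%:E + \sum_(N <= k <oo) (sqnorm (c k))%:E)%E.
Proof.
move=> c2; rewrite -energyE// (nneseries_split _ N).
  by rewrite add0n sumEFin.
by move=> k _; rewrite lee_fin sqnorm_ge0.
Qed.

Lemma truncate_sum N c :
  ((\sum_(0 <= k <oo) (sqnorm (truncate N c k))%:E)%E =
   (\sum_(0 <= k < N) sqnorm (c k))%:E).
Proof.
rewrite (nneseries_split _ N); last by move=> k _; rewrite lee_fin sqnorm_ge0.
rewrite add0n [X in (_ + X)%E]eseries0 ?adde0 ?sumEFin; last first.
  by move=> k Nk _; rewrite /truncate ltnNge Nk sqnorm0.
congr (_%:E); rewrite big_nat [RHS]big_nat; apply: eq_bigr => k /andP[_ kN].
by rewrite /truncate kN.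
Qed.

Lemma ell2_truncate N c : ell2 (truncate N c).
Proof. by rewrite /ell2 truncate_sum ltry. Qed.

Lemma energy_truncate N c : energy (truncate N c) = \sum_(0 <= k < N) sqnorm (c k).
Proof. by rewrite /energy truncate_sum. Qed.

Lemma tail_sum N c : ell2 c ->
  ((\sum_(0 <= k <oo) (sqnorm (c k - truncate N c k))%:E)%E =
   (energy c - \sum_(0 <= k < N) sqnorm (c k))%:E).
Proof.
move=> c2; rewrite (nneseries_split _ N); last by move=> k _; rewrite lee_fin sqnorm_ge0.
rewrite add0n big_nat big1 ?add0e; last first.
  by move=> k /andP[_ kN]; rewrite /truncate kN subrr sqnorm0.
rewrite EFinB (energy_split N c2) addeAC subee// add0e.
rewrite eseries_cond [RHS]eseries_cond; apply: eq_eseriesr => k /andP[_ Nk].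
by rewrite /truncate ltnNge Nk subr0.
Qed.

Lemma ell2_tail N c : ell2 c -> ell2 (fun k => c k - truncate N c k).
Proof. by move=> c2; rewrite /ell2 tail_sum// ltry. Qed.

Lemma energy_tail N c : ell2 c ->
  energy (fun k => c k - truncate N c k) = energy c - \sum_(0 <= k < N) sqnorm (c k).
Proof. by move=> c2; rewrite /energy tail_sum. Qed.

Lemma energy_truncate_le N c : ell2 c -> energy (truncate N c) <= energy c.
Proof.
move=> c2; rewrite energy_truncate -subr_ge0 -energy_tail//; exact: energy_ge0.
Qed.

Lemma energy_truncate_cvg c : ell2 c -> energy (truncate N c) @[N --> \oo] --> energy c.
Proof.
move=> c2; under eq_fun do rewrite energy_truncate.
have : (\sum_(0 <= k < N) (sqnorm (c k))%:E @[N --> \oo] --> (energy c)%:E)%E.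
  rewrite -energyE//; apply: is_cvg_nneseries => k _ _.
  by rewrite lee_fin sqnorm_ge0.
by under eq_fun do rewrite sumEFin; move/fine_cvgP => [].
Qed.

Lemma energy_gt0 c : ell2 c -> (exists k, c k != 0) -> 0 < energy c.
Proof.
move=> c2 [k ck]; apply: (lt_le_trans _ (energy_truncate_le k.+1 c2)).
rewrite energy_truncate big_nat_recr//= ltr_wpDl ?sumr_ge0//.
  by move=> i _; exact: sqnorm_ge0.
by rewrite lt0r sqnorm_eq0 ck sqnorm_ge0.
Qed.

End square_summable.

Section spectral_functional.
Variables (R : realType) (d : nat).
Local Notation E := 'rV[R]_d.+1.
Local Notation mu := (@lebesgue_Rn R d).
Local Notation Re := complex.Re.
Variables (Omega omega : set E) (lam : nat -> R) (phi : nat -> E -> R[i]).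
Hypothesis mO : measurable (Omega : set (lebesgue_space R d)).
Hypothesis mo : measurable (omega : set (lebesgue_space R d)).
Hypothesis oO : omega `<=` Omega.
Hypothesis L2phi : forall j, L2 Omega (phi j).
Hypothesis orth : forall j k, L2inner Omega (phi j) (phi k) = (j == k)%:R.
Hypothesis fin_eig : forall l, finite_set (eigenspace_index lam l).
Implicit Types c : nat -> R[i].
Local Opaque L2.

Let L2phi_omega j : L2 omega (phi j).
Proof. exact: (L2S mo mO oO (L2phi j)). Qed.

Lemma L2sq_orthonormal (s : seq nat) c : uniq s ->
  L2sq Omega (fun x => \sum_(j <- s) c j * phi j x) = \sum_(j <- s) sqnorm (c j).
Proof.
move=> us; rewrite (L2sq_sum mO s c L2phi) big_seq [RHS]big_seq; apply: eq_bigr => j js.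
rewrite (bigD1_seq j)//= orth eqxx mulr1 mulcJE/= big1 ?addr0// => k kj.
by rewrite orth eq_sym (negbTE kj) mulr0.
Qed.

Lemma same_eigenvalue_exists j : exists k, lam k == lam j.
Proof. by exists j. Qed.

(** The smallest index with the same eigenvalue as j stands for that eigenvalue,
    so that sums over distinct eigenvalues become series over nat. *)
Definition first_index j : nat := ex_minn (same_eigenvalue_exists j).

Lemma lam_first_index j : lam (first_index j) = lam j.
Proof. by rewrite /first_index; case: ex_minnP => k /eqP. Qed.

Lemma first_index_min j k : lam k = lam j -> (first_index j <= k)%N.
Proof. by rewrite /first_index; case: ex_minnP => m _ mmin kj; rewrite mmin// kj. Qed.

Lemma first_index_eq j k : (first_index j == first_index k) = (lam j == lam k).
Proof.
apply/eqP/eqP => [jk|jk]; first by rewrite -(lam_first_index j) jk lam_first_index.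
by apply/eqP; rewrite eqn_leq !first_index_min ?lam_first_index.
Qed.

Lemma first_index_idem j : first_index (first_index j) = first_index j.
Proof. by apply/eqP; rewrite first_index_eq lam_first_index. Qed.

(** Empty unless m is the first index of its eigenvalue: the sets class_set m
    form a partition of nat indexed by nat itself. *)
Definition class_set m : set nat := [set k | first_index k = m].

Lemma class_setE m : first_index m = m -> class_set m = eigenspace_index lam (lam m).
Proof.
move=> mm; apply/seteqP; split => k /=; first by move=> <-; rewrite lam_first_index.
by move=> km; rewrite -mm; apply/eqP; rewrite first_index_eq km.
Qed.

Lemma class_set_not_first m : first_index m != m -> class_set m = set0.
Proof.
move=> mm; apply/seteqP; split => // k /= km; move/eqP: mm; apply.
by rewrite -km first_index_idem.
Qed.

Lemma finite_class_set m : finite_set (class_set m).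
Proof.
by have [/class_setE->|/class_set_not_first->] := eqVneq (first_index m) m.
Qed.

Definition class_seq m : seq nat := finmap.enum_fset (fset_set (class_set m)).

Lemma mem_class_seq m k : (k \in class_seq m) = (first_index k == m).
Proof.
rewrite in_fset_set; last exact: finite_class_set.
by apply/idP/eqP; rewrite inE.
Qed.

Lemma uniq_class_seq m : uniq (class_seq m).
Proof. exact: finmap.fset_uniq. Qed.

Lemma class_seq_not_first m : first_index m != m -> class_seq m = [::].
Proof. by move=> /class_set_not_first cm; rewrite /class_seq cm fset_set0. Qed.

Definition eigencomponent c m : E -> R[i] :=
  fun x => \sum_(k <- class_seq m) c k * phi k x.

Lemma L2_eigencomponent c m : L2 omega (eigencomponent c m).
Proof. by apply: (L2_sum mo) => k; exact: (L2Z mo (c k) (L2phi_omega k)). Qed.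

Lemma eigencomponent_not_first c m : first_index m != m -> eigencomponent c m = (fun=> 0).
Proof.
by move=> mm; apply/funext => x; rewrite /eigencomponent class_seq_not_first ?big_nil.
Qed.

Lemma L2sq0 : L2sq omega (fun=> 0 : R[i]) = 0.
Proof. by rewrite /L2sq sqnorm0 Rintegral_cst// mul0r. Qed.

(** The numerator of the spectral quotient, by spectral_integral. *)
Definition spectral c : R := fine (\sum_(0 <= m <oo) (L2sq omega (eigencomponent c m))%:E)%E.

Lemma spectral_series_ge0 c :
  (0 <= \sum_(0 <= m <oo) (L2sq omega (eigencomponent c m))%:E)%E.
Proof. by apply: nneseries_ge0 => m _ _; rewrite lee_fin L2sq_ge0. Qed.

(** Distinct eigenvalues correspond to first indices, at all other indices the
    eigencomponent is 0, and series of nonnegative functions commute with the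
    integral. *)
Lemma spectral_integral c :
  ((\int[mu]_(x in omega) \esum_(l in range lam)
      (sqnorm (\sum_(k \in eigenspace_index lam l) c k * phi k x)%R)%:E) =
   \sum_(0 <= m <oo) (L2sq omega (eigencomponent c m))%:E)%E.
Proof.
transitivity (\int[mu]_(x in omega) \sum_(0 <= m <oo) (sqnorm (eigencomponent c m x))%:E)%E.
  apply: eq_integral => x _.
  have -> : range lam = lam @` [set m | first_index m == m].
    apply/seteqP; split => [_ [j _ <-]|_ [j _ <-]]; last by exists j.
    exists (first_index j); last exact: lam_first_index.
    by rewrite /= first_index_idem.
  rewrite (esum_pred_image (fun l => (sqnorm (\sum_(k \in eigenspace_index lam l) c k * phi k x)%R)%:E)).
  - rewrite eseries_mkcond; apply: eq_eseriesr => m _.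
    case: ifPn => [/eqP mm|mm]; last by rewrite eigencomponent_not_first// sqnorm0.
    by rewrite /eigencomponent /class_seq -fsbig_finite ?class_setE//; exact: finite_class_set.
  - by move=> m _; rewrite lee_fin sqnorm_ge0.
  - move=> m1 m2; rewrite !inE/= => /eqP m11 /eqP m22 /eqP.
    by rewrite -first_index_eq m11 m22 => /eqP.
rewrite (integral_nneseries _ mo).
- apply: eq_eseriesr => m _; exact: (sqL2normE mo (L2_eigencomponent c m)).
- move=> m; have [mr mi _] := L2E (L2_eigencomponent c m).
  by apply/measurable_EFinP; exact: measurable_sqnorm.
- by move=> m x _; rewrite lee_fin sqnorm_ge0.
Qed.

(** On Omega the squared norm of an eigencomponent is the sum of the |c_k|^2 over
    its class, by orthonormality, and the classes partition the indices. *)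
Lemma spectral_series_le c : (\sum_(0 <= m <oo) (L2sq omega (eigencomponent c m))%:E <=
  \sum_(0 <= k <oo) (sqnorm (c k))%:E)%E.
Proof.
have -> : (\sum_(0 <= k <oo) (sqnorm (c k))%:E =
    \sum_(0 <= m <oo) (L2sq Omega (eigencomponent c m))%:E)%E.
  rewrite nneseries_esumT; last by move=> k; rewrite lee_fin sqnorm_ge0.
  rewrite nneseries_esumT; last by move=> k; rewrite lee_fin L2sq_ge0.
  have -> : [set: nat] = \bigcup_(m in [set: nat]) class_set m.
    by apply/seteqP; split => // k _; exists (first_index k).
  rewrite esum_bigcupT.
  - have <- : [set: nat] = \bigcup_(m in [set: nat]) class_set m.
      by apply/seteqP; split => // k _; exists (first_index k).
    apply: eq_esum => m _; rewrite esum_fset; last first.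
    - by move=> k _; rewrite lee_fin sqnorm_ge0.
    - exact: finite_class_set.
    rewrite fsbig_finite; last exact: finite_class_set.
    by rewrite sumEFin /eigencomponent L2sq_orthonormal// uniq_class_seq.
  - by apply/trivIsetP => m1 m2 _ _ /eqP m12; apply/seteqP; split => // k [/= k1 k2]; apply: m12; rewrite -k1.
  - by move=> k; rewrite lee_fin sqnorm_ge0.
apply: lee_nneseries => m _; rewrite lee_fin ?L2sq_ge0//.
apply: (L2sqS mo mO oO); apply: (L2_sum mO) => k; exact: (L2Z mO (c k) (L2phi k)).
Qed.

Lemma spectralE c : ell2 c ->
  (\sum_(0 <= m <oo) (L2sq omega (eigencomponent c m))%:E)%E = (spectral c)%:E.
Proof.
move=> c2; rewrite /spectral fineK// ge0_fin_numE ?spectral_series_ge0//.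
exact: le_lt_trans (spectral_series_le c) c2.
Qed.

Lemma spectral_le_energy c : ell2 c -> spectral c <= energy c.
Proof. by move=> c2; rewrite -lee_fin -spectralE// -energyE//; exact: spectral_series_le. Qed.

Lemma spectral_quotientE c : ell2 c -> 0 < energy c ->
  spectral_quotient lam phi omega c = (spectral c / energy c)%:E.
Proof.
move=> c2 c0; rewrite /spectral_quotient spectral_integral spectralE// energyE//.
by rewrite inver gt_eqF// EFinM.
Qed.

(** The spectral functional is a sum of squared seminorms of functions that
    depend linearly on c. *)
Lemma spectral_young (e : R) c b : 0 < e -> ell2 c -> ell2 b ->
  ell2 (fun k => c k - b k) ->
  spectral c <= (1 + e) * spectral b + (1 + e^-1) * spectral (fun k => c k - b k).
Proof.
move=> e0 c2 b2 cb2.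
have e1 : 0 <= 1 + e by rewrite addr_ge0// ltW.
have e2 : 0 <= 1 + e^-1 by rewrite addr_ge0// invr_ge0 ltW.
rewrite -lee_fin EFinD (EFinM (1 + e)) (EFinM (1 + e^-1)) -[X in (X <= _)%E](spectralE c2).
rewrite -[X in (_ <= _ * X + _)%E](spectralE b2) -[X in (_ <= _ + _ * X)%E](spectralE cb2).
rewrite -!nneseriesZl; [|by move=> *; rewrite lee_fin L2sq_ge0..].
rewrite -nneseriesD; [|by move=> *; rewrite mule_ge0 ?lee_fin ?L2sq_ge0..].
apply: lee_nneseries => m _; first by rewrite lee_fin L2sq_ge0.
rewrite -!EFinM -EFinD lee_fin.
have -> : eigencomponent (fun k => c k - b k) m =
    (fun x => eigencomponent c m x - eigencomponent b m x).
  apply/funext => x; rewrite /eigencomponent -sumrB; apply: eq_bigr => k _.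
  by rewrite mulrBl.
exact: (L2sq_young mo e0 (L2_eigencomponent c m) (L2_eigencomponent b m)).
Qed.

(** The tail of the energy; the summand 1 / (N + 1) makes it positive even if c
    is finitely supported, so that young_dist applies. *)
Definition tail_bound c N : R :=
  energy c - \sum_(0 <= k < N) sqnorm (c k) + N.+1%:R^-1.

Definition approx_error c N : R :=
  Num.sqrt (tail_bound c N) * (energy c + 1) + tail_bound c N.

Lemma tail_bound_gt0 c N : ell2 c -> 0 < tail_bound c N.
Proof. by move=> c2; rewrite ltr_wpDl -?energy_tail// energy_ge0. Qed.

Lemma approx_error_cvg0 c : ell2 c -> approx_error c N @[N --> \oo] --> 0.
Proof.
move=> c2; apply: sqrt_bound_cvg0.
rewrite [X in _ --> X](_ : 0 = energy c - energy c + 0); last by rewrite subrr addr0.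
apply: cvgD; last exact: cvg_harmonic.
apply: cvgB; first exact: cvg_cst.
rewrite (_ : (fun N => _) = (fun N => energy (truncate N c))).
  exact: energy_truncate_cvg.
by apply/funext => N; rewrite energy_truncate.
Qed.

Lemma spectral_truncate_dist c N : ell2 c ->
  `|spectral (truncate N c) - spectral c| <= approx_error c N.
Proof.
move=> c2; have t2 := ell2_truncate N c; have tl2 := ell2_tail N c2.
have tl2' : ell2 (fun k => truncate N c k - c k).
  by rewrite /ell2; under eq_eseriesr do rewrite -sqnormN opprB.
have tb a : spectral (fun k => a k) <= energy c - \sum_(0 <= k < N) sqnorm (c k) ->
    spectral a <= tail_bound c N.
  by move=> /le_trans; apply; rewrite lerDl invr_ge0.
have tail1 : spectral (fun k => c k - truncate N c k) <= tail_bound c N.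
  by apply: tb; rewrite -energy_tail//; exact: spectral_le_energy.
have tail2 : spectral (fun k => truncate N c k - c k) <= tail_bound c N.
  apply: tb; apply: le_trans (spectral_le_energy tl2') _; rewrite -energy_tail//.
  by rewrite /energy; under eq_eseriesr do rewrite -sqnormN opprB.
have inv0 (a : R) : 0 < a -> 0 <= 1 + a^-1.
  by move=> a0; rewrite addr_ge0// invr_ge0 ltW.
apply: young_dist => [|||a a0|a a0].
- exact: tail_bound_gt0.
- exact: le_trans (spectral_le_energy t2) (energy_truncate_le N c2).
- exact: spectral_le_energy.
- apply: (le_trans (spectral_young a0 t2 c2 tl2')).
  by rewrite lerD2l; exact: (ler_wpM2l (inv0 a a0) tail2).
- apply: (le_trans (spectral_young a0 c2 t2 tl2)).
  by rewrite lerD2l; exact: (ler_wpM2l (inv0 a a0) tail1).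
Qed.

Lemma spectral_truncate_cvg c : ell2 c ->
  spectral (truncate N c) @[N --> \oo] --> spectral c.
Proof.
move=> c2; apply/cvgrPdist_le => e e0; have /cvgrPdist_le/(_ _ e0) := approx_error_cvg0 c2.
apply: filterS => N; rewrite sub0r normrN => h; rewrite distrC.
exact: le_trans (spectral_truncate_dist N c2) (le_trans (ler_norm _) h).
Qed.

Lemma sum_class_truncate (f : nat -> R[i]) N m :
  \sum_(k <- class_seq m) (if (k < N)%N then f k else 0) =
  \sum_(0 <= k < N | first_index k == m) f k.
Proof.
rewrite -big_mkcond -big_filter -[RHS]big_filter; apply: perm_big.
apply: uniq_perm; [exact/filter_uniq/uniq_class_seq|exact/filter_uniq/iota_uniq|].
by move=> k; rewrite !mem_filter mem_class_seq mem_index_iota andbC.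
Qed.

Lemma eigencomponent_truncate c N m x : eigencomponent (truncate N c) m x =
  \sum_(0 <= k < N | first_index k == m) c k * phi k x.
Proof.
rewrite -sum_class_truncate; apply: eq_bigr => k _; rewrite /truncate.
by case: ifP; rewrite ?mul0r.
Qed.

Lemma spectral_truncate c N :
  spectral (truncate N c) = \sum_(m < N) L2sq omega (eigencomponent (truncate N c) m).
Proof.
rewrite /spectral (nneseries_split _ N); last by move=> *; rewrite lee_fin L2sq_ge0.
rewrite add0n [X in (_ + X)%E]eseries0 ?adde0 ?sumEFin ?big_mkord//.
move=> m Nm _; rewrite (_ : eigencomponent _ m = fun=> 0) ?L2sq0//.
apply/funext => x; rewrite eigencomponent_truncate big_nat_cond big1// => k.
move=> /andP[/andP[_ kN] /eqP km]; have := first_index_min (erefl (lam k)).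
by rewrite km leqNgt (leq_trans kN Nm).
Qed.

(** All indices of a class carry the same phase. *)
Lemma evolution_by_class c N t x :
  \sum_(0 <= j < N) expi (lam j * t) * c j * phi j x =
  \sum_(m < N) expi (lam m * t) * eigencomponent (truncate N c) m x.
Proof.
rewrite big_mkord.
have fN (j : 'I_N) : (first_index j < N)%N.
  exact: leq_ltn_trans (first_index_min (erefl (lam j))) (ltn_ord j).
rewrite (partition_big (fun j => Ordinal (fN j)) xpredT)//=; apply: eq_bigr => m _.
rewrite eigencomponent_truncate big_mkord mulr_sumr.
apply: eq_big => [j|j /eqP <-]; first by rewrite -val_eqE.
by rewrite /= lam_first_index mulrA.
Qed.

Lemma L2sq_evolution c N t :
  L2sq omega (fun x => \sum_(0 <= j < N) expi (lam j * t) * c j * phi j x) =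
  \sum_(m < N) \sum_(p < N) Re (expi ((lam m - lam p) * t) *
    L2inner omega (eigencomponent (truncate N c) m) (eigencomponent (truncate N c) p)).
Proof.
under [X in L2sq _ X]eq_fun do rewrite evolution_by_class.
rewrite (L2sq_sum mo _ (fun m : 'I_N => expi (lam m * t))
  (fun m : 'I_N => L2_eigencomponent (truncate N c) m)).
apply: eq_bigr => m _; apply: eq_bigr => p _.
by rewrite mulrBl expiD expiN.
Qed.

Lemma continuous_L2sq_evolution c N :
  continuous (fun t => L2sq omega (fun x => \sum_(0 <= j < N) expi (lam j * t) * c j * phi j x)).
Proof.
under [X in continuous X]eq_fun do rewrite L2sq_evolution.
apply: continuous_sum => m; apply: continuous_sum => p.
exact: continuous_oscillation.
Qed.

(** Cross terms of distinct eigenvalues average out. Two different indices with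
    the same eigenvalue cannot both be first indices, so one of their eigencomponents is 0. *)
Lemma time_mean_evolution c N :
  time_mean (fun t => L2sq omega (fun x => \sum_(0 <= j < N) expi (lam j * t) * c j * phi j x)) T
    @[T --> +oo] --> spectral (truncate N c).
Proof.
set B := eigencomponent (truncate N c).
have co m p := @continuous_oscillation _ (lam m - lam p) (L2inner omega (B m) (B p)).
rewrite (_ : (fun T => _) = (fun T => \sum_(m < N) \sum_(p < N)
  time_mean (fun t => Re (expi ((lam m - lam p) * t) * L2inner omega (B m) (B p))) T));
  last first.
  apply/funext => T; under [X in time_mean X]eq_fun do rewrite L2sq_evolution.
  rewrite time_mean_sum; last by move=> m; apply: continuous_sum => p; exact: co.
  by apply: eq_bigr => m _; rewrite time_mean_sum// => p; exact: co.
have -> : spectral (truncate N c) = \sum_(m < N) \sum_(p < N)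
    (if lam m - lam p == 0 then Re (L2inner omega (B m) (B p)) else 0).
  rewrite spectral_truncate; apply: eq_bigr => m _.
  have L2B : L2 omega (B m) := L2_eigencomponent (truncate N c) m.
  rewrite (bigD1 m)// subrr eqxx (L2sq_L2inner mo L2B) -/(B m) /= big1 ?addr0// => p pm.
  rewrite subr_eq0; case: ifPn => // lmp.
  suff BB x : B m x * conjc (B p x) = 0.
    by under eq_Rintegral do rewrite BB; rewrite Rintegral_cst// mul0r.
  have [mm|mm] := eqVneq (first_index m) m; last first.
    by rewrite /B eigencomponent_not_first// mul0r.
  have pp : first_index p != p.
    apply: contra pm => /eqP pp; rewrite -val_eqE/= -mm -[X in X == _]pp.
    by rewrite first_index_eq eq_sym.
  by rewrite /B (eigencomponent_not_first _ pp) conjc0 mulr0.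
apply: cvg_sumr => m; apply: cvg_sumr => p; exact: time_mean_oscillation.
Qed.

End spectral_functional.

(** * Solutions of the Schrodinger equation *)

Section derivative_quotient.
Variable R : realType.
Implicit Types (f : R -> R).

Lemma is_derive_quotientP f (t l : R) :
  is_derive t (1 : R) f l <-> (h^-1 * (f (t + h) - f t) @[h --> 0^'] --> l).
Proof.
have quotE : (fun h => h^-1 * (f (t + h) - f t)) =
    (fun h => h^-1 *: ((f \o shift t) (h *: (1 : R)) - f t)).
  by apply/funext => h; rewrite /= [h *: _]mulr1 (addrC h).
rewrite quotE; split => fl.
  have := @ex_derive _ _ _ _ _ _ _ fl; rewrite /derivable.
  by rewrite -(@derive_val _ _ _ _ _ _ _ fl).
by apply: DeriveDef; [apply/cvg_ex; exists l|exact: cvg_lim].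
Qed.

End derivative_quotient.

Section dirichlet_evolution.
Variables (R : realType) (d : nat).
Local Notation E := 'rV[R]_d.+1.
Local Notation Re := complex.Re.
Local Notation Im := complex.Im.
Variables (Omega omega : set E) (V : E -> R) (lam : nat -> R) (phi : nat -> E -> R[i]).
Hypothesis Omega_open : open Omega.
Hypothesis Omega_bounded : bounded_set Omega.
Hypothesis V_Linfty : Linfty Omega V.
Hypothesis basis : spectral_basis Omega V lam phi.
Hypothesis mo : measurable (omega : set (lebesgue_space R d)).
Hypothesis oO : omega `<=` Omega.
Local Opaque L2.

Let mO : measurable (Omega : set (lebesgue_space R d)).
Proof. exact: open_measurable_Rn. Qed.

Let L2phi j : L2 Omega (phi j).
Proof. by case: basis => -[]. Qed.

Let orth j k : L2inner Omega (phi j) (phi k) = (j == k)%:R.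
Proof. by case: basis => -[]. Qed.

Let eig j : eigenfunction Omega V (lam j) (phi j).
Proof. by case: basis. Qed.

Let fin_eig l : finite_set (eigenspace_index lam l).
Proof. by case: basis. Qed.

Local Notation coef f := (fun j => L2inner Omega f (phi j)).

Lemma L2_lincomb (s : seq nat) (z : nat -> R[i]) : L2 Omega (fun x => \sum_(j <- s) z j * phi j x).
Proof. by apply: (L2_sum mO) => j; exact: (L2Z mO (z j) (L2phi j)). Qed.

Lemma coef_lincomb N (z : nat -> R[i]) k :
  L2inner Omega (fun x => \sum_(0 <= j < N) z j * phi j x) (phi k) = truncate N z k.
Proof.
rewrite (L2inner_suml mO _ (fun j => L2Z mO (z j) (L2phi j)) (L2phi k)).
under eq_bigr => j _ do rewrite (L2innerZl mO _ (L2phi j) (L2phi k)) orth.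
rewrite /truncate; case: ifPn => [kN|]; last first.
  rewrite -leqNgt => Nk; rewrite big_nat big1// => j /andP[_ jN].
  by rewrite ltn_eqF ?mulr0// (leq_trans jN Nk).
rewrite (bigD1_seq k) ?mem_index_iota ?iota_uniq//= eqxx mulr1 big1 ?addr0// => j jk.
by rewrite (negbTE jk) mulr0.
Qed.

Lemma bessel_identity f N : L2 Omega f ->
  L2sq Omega (fun x => f x - \sum_(0 <= j < N) coef f j * phi j x) =
  L2sq Omega f - \sum_(0 <= j < N) sqnorm (coef f j).
Proof.
move=> L2f; have L2s := L2_lincomb (index_iota 0 N) (coef f).
rewrite (L2sqB mO L2f L2s) L2sq_orthonormal ?iota_uniq//.
rewrite (L2inner_sumr mO _ (fun j => L2Z mO (coef f j) (L2phi j)) L2f).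
rewrite (_ : Re _ = \sum_(0 <= j < N) sqnorm (coef f j)); first by ring.
rewrite Re_sumc; apply: eq_bigr => j _.
by rewrite (L2innerZr mO _ (L2phi j) L2f) mulrC mulcJE.
Qed.

(** In an orthonormal basis the residual of the Bessel identity tends to 0. *)
Lemma parseval f : L2 Omega f ->
  (\sum_(0 <= k <oo) (sqnorm (coef f k))%:E)%E = (L2sq Omega f)%:E.
Proof.
move=> L2f; case: basis => -[_ _ /(_ f L2f) fcvg] _ _.
have {}fcvg : L2sq Omega f - \sum_(0 <= j < N) sqnorm (coef f j) @[N --> \oo] --> 0.
  under eq_fun do rewrite -bessel_identity//.
  apply/(sqL2norm_cvg0P mO); first by move=> N; exact: (L2B mO L2f (L2_lincomb _ _)).
  by under eq_fun do under [X in sqL2norm _ X]eq_fun do rewrite big_mkord.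
apply/cvg_lim => //.
rewrite (_ : (fun N => _) = (fun N => (\sum_(0 <= j < N) sqnorm (coef f j))%:E)); last first.
  by apply/funext => N; rewrite sumEFin.
apply/fine_cvgP; split; first exact: nearW.
rewrite -[X in _ --> X](subr0 (L2sq Omega f)).
rewrite (_ : _ \o _ = (fun N => L2sq Omega f - (L2sq Omega f - \sum_(0 <= j < N) sqnorm (coef f j)))).
  by apply: cvgB => //; exact: cvg_cst.
by apply/funext => N /=; ring.
Qed.

Lemma ell2_coef f : L2 Omega f -> ell2 (coef f).
Proof. by move=> L2f; rewrite /ell2 parseval// ltry. Qed.

Lemma energy_coef f : L2 Omega f -> energy (coef f) = L2sq Omega f.
Proof. by move=> L2f; rewrite /energy parseval. Qed.

(** Taking a coefficient is continuous on L^2, so it commutes with the L^2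
    derivative in time. *)
Lemma is_derive_coef (u du : R -> E -> R[i]) t j : (forall t, L2 Omega (u t)) ->
  (forall t, L2 Omega (du t)) ->
  sqL2norm Omega (fun x => (h^-1)%:C * (u (t + h) x - u t x) - du t x)
      @[h --> 0^'] --> 0%E ->
  is_derive t (1 : R) (fun t => Re (coef (u t) j)) (Re (coef (du t) j)) /\
  is_derive t (1 : R) (fun t => Im (coef (u t) j)) (Im (coef (du t) j)).
Proof.
move=> L2u L2du du_lim.
have L2q h : L2 Omega (fun x => (h^-1)%:C * (u (t + h) x - u t x) - du t x).
  exact: (L2B mO (L2Z mO (h^-1)%:C (L2B mO (L2u (t + h)) (L2u t))) (L2du t)).
have qlim : cvanish (0^' : set_system R) (fun h : R =>
    (h^-1)%:C * (coef (u (t + h)) j - coef (u t) j) - coef (du t) j).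
  have := du_lim => /(L2inner_cvanish mO (L2phi j) L2q); apply: cvanish_le => h.
  rewrite -[leRHS]sqnormJ (L2innerJ mO (L2phi j) (L2q h)).
  rewrite (L2innerBl mO (L2Z mO (h^-1)%:C (L2B mO (L2u (t + h)) (L2u t))) (L2du t) (L2phi j)).
  rewrite (L2innerZl mO _ (L2B mO (L2u (t + h)) (L2u t)) (L2phi j)).
  by rewrite (L2innerBl mO (L2u (t + h)) (L2u t) (L2phi j)).
split; apply/is_derive_quotientP.
- rewrite (_ : (fun h => _) = (fun h =>
      Re ((h^-1)%:C * (coef (u (t + h)) j - coef (u t) j)))); first exact: cvanishB_Re.
  by apply/funext => h; rewrite !ReImE /= mul0r subr0.
- rewrite (_ : (fun h => _) = (fun h =>
      Im ((h^-1)%:C * (coef (u (t + h)) j - coef (u t) j)))); first exact: cvanishB_Im.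
  by apply/funext => h; rewrite !ReImE /= mul0r addr0.
Qed.

(** Rotating (a, b) back by the angle l t gives a pair with zero derivative. *)
Lemma rotation_ode (l : R) (a b : R -> R) :
  (forall t, is_derive t (1 : R) a (- (l * b t))) ->
  (forall t, is_derive t (1 : R) b (l * a t)) ->
  forall t, a t +i* b t = expi (l * t) * (a 0 +i* b 0).
Proof.
move=> da db t.
have dp s : is_derive s (1 : R) (fun t => cos (l * t) * a t + sin (l * t) * b t) 0.
  have := da s; have := db s => das dbs.
  by apply: is_derive_eq; rewrite /GRing.scale/=; ring.
have dq s : is_derive s (1 : R) (fun t => cos (l * t) * b t - sin (l * t) * a t) 0.
  have := da s; have := db s => das dbs.
  by apply: is_derive_eq; rewrite /GRing.scale/=; ring.
have := @is_derive_0_is_cst _ _ t 0 dp; rewrite mulr0 cos0 sin0 mul1r mul0r addr0 => p0.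
have := @is_derive_0_is_cst _ _ t 0 dq; rewrite mulr0 cos0 sin0 mul1r mul0r subr0 => q0.
rewrite -p0 -q0; have cs := cos2Dsin2 (l * t).
apply: complexP; rewrite !ReImE /=.
  by rewrite -[LHS]mul1r -cs; ring.
by rewrite -[LHS]mul1r -cs; ring.
Qed.

(** The coefficient of du(t) is i lam_j times that of u(t), so that both rotate
    with angular velocity lam_j. *)
Lemma solution_coef u0 (u du : R -> E -> R[i]) : schrodinger_solution Omega V u0 u du ->
  forall t j, coef (du t) j = expi (lam j * t) * coef (du 0) j.
Proof.
move=> [L2u L2du dlim _ bdry eqn _] t j.
have du_u s : coef (du s) j = (0 +i* lam j) * coef (u s) j.
  have := eigenfunction_component mO Omega_bounded V_Linfty (bdry s)
    (L2Z mO (0 +i* 1) (L2du s)) (eqn s) (eig j).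
  rewrite (L2innerZl mO _ (L2du s) (L2phi j)) => h.
  rewrite (_ : coef (du s) j = - (0 +i* 1) * ((0 +i* 1) * coef (du s) j)).
    by rewrite h; apply: complexP; rewrite !ReImE /=; ring.
  by apply: complexP; rewrite !ReImE /=; ring.
have uE s : coef (u s) j = expi (lam j * s) * coef (u 0) j.
  have := @rotation_ode (lam j) (fun s => Re (coef (u s) j)) (fun s => Im (coef (u s) j)).
  have dRe r : is_derive r (1 : R) (fun s => Re (coef (u s) j)) (- (lam j * Im (coef (u r) j))).
    have [+ _] := is_derive_coef j L2u L2du (dlim r).
    by rewrite du_u !ReImE /= mul0r sub0r.
  have dIm r : is_derive r (1 : R) (fun s => Im (coef (u s) j)) (lam j * Re (coef (u r) j)).
    have [_ +] := is_derive_coef j L2u L2du (dlim r).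
    by rewrite du_u !ReImE /= mul0r add0r.
  move=> /(_ dRe dIm s) h; apply: complexP.
    by rewrite -[LHS]/(Re (_ +i* Im (coef (u s) j))) h !ReImE.
  by rewrite -[LHS]/(Im (Re (coef (u s) j) +i* _)) h !ReImE.
by rewrite !du_u (uE t) mulrCA.
Qed.

(** By polarization about w t. Continuity makes the squared norm on omega
    integrable over bounded time intervals. *)
Lemma continuous_L2sq (w : R -> E -> R[i]) : (forall t, L2 Omega (w t)) ->
  (forall t, sqL2norm Omega (fun x => w s x - w t x) @[s --> t] --> 0%E) ->
  continuous (fun t => L2sq omega (w t)).
Proof.
move=> L2w wcont t.
have L2ww s : L2 Omega (fun x => w s x - w t x) := L2B mO (L2w s) (L2w t).
have L2o f : L2 Omega f -> L2 omega f := @L2S _ _ _ _ mo mO oO f.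
have /(sqL2norm_cvg0P mO L2ww) nO := wcont t.
have no : L2sq omega (fun x => w s x - w t x) @[s --> t] --> 0.
  apply: (@squeeze_cvgr _ _ _ _ (fun=> 0) (fun s => L2sq Omega (fun x => w s x - w t x))) => //.
    by apply: nearW => s; rewrite L2sq_ge0 (L2sqS mo mO oO (L2ww s)).
  exact: cvg_cst.
have inner0 : cvanish (nbhs t) (fun s => L2inner omega (w t) (fun x => w s x - w t x)).
  apply: (L2inner_cvanish mo (L2o _ (L2w t)) (fun s => L2o _ (L2ww s))).
  by apply/(sqL2norm_cvg0P mo (fun s => L2o _ (L2ww s))).
suff : L2sq omega (w s) @[s --> t] --> L2sq omega (w t) by [].
rewrite (_ : (fun s => _) = (fun s => L2sq omega (fun x => w s x - w t x) +
  2 * Re (L2inner omega (w t) (fun x => w s x - w t x)) + L2sq omega (w t))); last first.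
  apply/funext => s.
  rewrite (L2sqB mo (L2o _ (L2w s)) (L2o _ (L2w t))).
  rewrite (L2innerBr mo (L2o _ (L2w s)) (L2o _ (L2w t)) (L2o _ (L2w t))).
  rewrite (L2sq_L2inner mo (L2o _ (L2w t))) -(L2innerJ mo (L2o _ (L2w s)) (L2o _ (L2w t))).
  by rewrite !ReImE /=; ring.
rewrite [X in _ --> X](_ : _ = 0 + 2 * 0 + L2sq omega (w t)); last by ring.
apply: cvgD; last exact: cvg_cst.
apply: (cvgD no); apply: cvgMr; exact: (cvanish_Re inner0).
Qed.

(** Parseval bounds the error of truncating the expansion of w t by the tail of
    the energy of c, uniformly in t because the phases have modulus one. *)
Lemma time_mean_spectral (w : R -> E -> R[i]) (c : nat -> R[i]) :
  (forall t, L2 Omega (w t)) -> (forall t j, coef (w t) j = expi (lam j * t) * c j) ->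
  continuous (fun t => L2sq omega (w t)) ->
  time_mean (fun t => L2sq omega (w t)) T @[T --> +oo] --> spectral omega lam phi c.
Proof.
move=> L2w wc cw.
have c2 : ell2 c.
  have := ell2_coef (L2w 0); rewrite /ell2.
  by under eq_eseriesr do rewrite wc sqnormM sqnorm_expi mul1r.
have energyE t : L2sq Omega (w t) = energy c.
  rewrite -energy_coef// /energy.
  by under eq_eseriesr do rewrite wc sqnormM sqnorm_expi mul1r.
pose S N t x := \sum_(0 <= j < N) expi (lam j * t) * c j * phi j x.
have L2S' N t : L2 Omega (S N t) := L2_lincomb (index_iota 0 N) (fun j => expi (lam j * t) * c j).
have L2o f : L2 Omega f -> L2 omega f := @L2S _ _ _ _ mo mO oO f.
apply: (@time_mean_cvg_approx _ _ (fun N t => L2sq omega (S N t)) (approx_error c)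
  (fun N => spectral omega lam phi (truncate N c))) => //.
- by move=> N; exact: (continuous_L2sq_evolution mO mo oO L2phi fin_eig).
- move=> N t.
  have SE : S N t = (fun x => \sum_(0 <= j < N) coef (w t) j * phi j x).
    by apply/funext => x; apply: eq_bigr => j _; rewrite wc.
  have tailE : L2sq Omega (fun x => w t x - S N t x) =
      energy c - \sum_(0 <= k < N) sqnorm (c k).
    rewrite SE bessel_identity// energyE; congr (_ - _); apply: eq_bigr => k _.
    by rewrite wc sqnormM sqnorm_expi mul1r.
  have le_tail f : L2 Omega f -> L2sq Omega f = energy c - \sum_(0 <= k < N) sqnorm (c k) ->
      L2sq omega f <= tail_bound c N.
    move=> L2f fE; apply: le_trans (L2sqS mo mO oO L2f) _.
    by rewrite fE lerDl invr_ge0.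
  have L2ws := L2B mO (L2w t) (L2S' N t); have L2sw := L2B mO (L2S' N t) (L2w t).
  have tail1 := le_tail _ L2ws tailE.
  have tail2 : L2sq omega (fun x => S N t x - w t x) <= tail_bound c N.
    apply: le_tail L2sw _; rewrite -tailE; apply: eq_Rintegral => x _.
    by rewrite -sqnormN opprB.
  have inv0 (a : R) : 0 < a -> 0 <= 1 + a^-1.
    by move=> a0; rewrite addr_ge0// invr_ge0 ltW.
  apply: young_dist => [|||a a0|a a0].
  + exact: tail_bound_gt0.
  + by rewrite -(energyE t); exact: (L2sqS mo mO oO (L2w t)).
  + apply: le_trans (L2sqS mo mO oO (L2S' N t)) _.
    rewrite (L2sq_orthonormal mO L2phi orth) ?iota_uniq//.
    under eq_bigr do rewrite sqnormM sqnorm_expi mul1r.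
    by rewrite -energy_truncate; exact: energy_truncate_le.
  + apply: le_trans (L2sq_young mo a0 (L2o _ (L2w t)) (L2o _ (L2S' N t))) _.
    by rewrite lerD2l; exact: (ler_wpM2l (inv0 a a0) tail1).
  + apply: le_trans (L2sq_young mo a0 (L2o _ (L2S' N t)) (L2o _ (L2w t))) _.
    by rewrite lerD2l; exact: (ler_wpM2l (inv0 a a0) tail2).
- by move=> N; exact: (spectral_truncate_dist mO mo oO L2phi orth fin_eig).
- by move=> N; exact: (time_mean_evolution mO mo oO L2phi fin_eig).
- exact: approx_error_cvg0.
Qed.

(** The coefficients of the initial velocity du(0) determine the limit. *)
Lemma time_average_cvg (u du : R -> E -> R[i]) : observable_solution Omega V u du ->
  [/\ ell2 (coef (du 0)), exists k, coef (du 0) k != 0 &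
   time_average Omega omega du T @[T --> +oo] -->
     spectral_quotient lam phi omega (coef (du 0))].
Proof.
move=> [u0 [_ sol du0]]; have L2du := solution_dL2 sol.
have c2 := ell2_coef (L2du 0); have cE := energy_coef (L2du 0).
have L2sq0 : L2sq Omega (du 0) != 0 by move: du0; rewrite (sqL2normE mO (L2du 0)).
have energy0 : 0 < energy (coef (du 0)) by rewrite cE lt0r L2sq0 L2sq_ge0.
split => //.
  apply: contrapT => /forallNP c0; move: energy0; rewrite /energy eseries0 ?ltxx// => k _ _.
  by have /negP := c0 k; rewrite negbK => /eqP ->; rewrite sqnorm0.
have cont := continuous_L2sq L2du (solution_C1 sol).
have mean := time_mean_spectral L2du (solution_coef sol) cont.
rewrite (spectral_quotientE mO mo oO L2phi orth fin_eig c2 energy0) cE.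
rewrite (_ : time_average Omega omega du = (fun T =>
    (time_mean (fun t => L2sq omega (du t)) T / L2sq Omega (du 0))%:E)).
  apply/fine_cvgP; split; first exact: nearW.
  by apply: cvgMl.
apply/funext => T; rewrite /time_average (sqL2normE mO (L2du 0)) inver (negbTE L2sq0).
under eq_integral => t _ do rewrite (sqL2normE mo (L2S mo mO oO (L2du t))).
rewrite -[(\int[_]_(t in _) _)%E]fineK; first by rewrite /time_mean -mulrA !EFinM.
exact: (integrable_fin_num _ (continuous_itv_integrable 0 T cont)).
Qed.

Lemma expi_derivative (l : R) :
  cvanish (0^' : set_system R) (fun h : R => (h^-1)%:C * (expi (l * h) - 1) - (0 +i* l)).
Proof.
have dcos : is_derive 0 (1 : R) (fun x => cos (l * x)) 0.
  by apply: is_derive_eq; rewrite /GRing.scale/= mulr0 sin0; ring.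
have dsin : is_derive 0 (1 : R) (fun x => sin (l * x)) l.
  by apply: is_derive_eq; rewrite /GRing.scale/= mulr0 cos0; ring.
apply: cvanishP.
  rewrite (_ : (fun h => _) = (fun h => h^-1 * (cos (l * (0 + h)) - cos (l * 0)))).
    exact/is_derive_quotientP.
  by apply/funext => h; rewrite !ReImE /= mul0r mulr0 cos0 !subr0 add0r.
rewrite -[X in _ --> X](subrr l).
rewrite (_ : (fun h => _) = (fun h => h^-1 * (sin (l * (0 + h)) - sin (l * 0)) - l)).
  apply: cvgB; [exact/is_derive_quotientP|exact: cvg_cst].
by apply/funext => h; rewrite !ReImE /= mul0r mulr0 sin0 !subr0 !addr0 add0r.
Qed.

Lemma continuous_expi (l t : R) : cvanish (nbhs t) (fun s => expi (l * s) - expi (l * t)).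
Proof.
have cl : {for t, continuous (fun t => l * t)} by apply: cvgMr; exact: cvg_id.
apply: cvanishP.
  rewrite (_ : (fun s => _) = (fun s => cos (l * s) - cos (l * t))); last first.
    by apply/funext => s; rewrite !ReImE.
  rewrite -[X in _ --> X](subrr (cos (l * t))); apply: cvgB; last exact: cvg_cst.
  by apply: (continuous_comp cl); exact: continuous_cos.
rewrite (_ : (fun s => _) = (fun s => sin (l * s) - sin (l * t))); last first.
  by apply/funext => s; rewrite !ReImE.
rewrite -[X in _ --> X](subrr (sin (l * t))); apply: cvgB; last exact: cvg_cst.
by apply: (continuous_comp cl); exact: continuous_sin.
Qed.

Lemma lincomb_cvg0 (I : Type) (F : set_system I) {FF : Filter F} N (z : I -> nat -> R[i]) :
  (forall j, cvanish F (z ^~ j)) ->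
  sqL2norm Omega (fun x => \sum_(0 <= j < N) z t j * phi j x) @[t --> F] --> 0%E.
Proof.
move=> z0; apply/(sqL2norm_cvg0P mO (fun t => L2_lincomb (index_iota 0 N) (z t))).
rewrite (_ : (fun t => _) = (fun t => \sum_(0 <= j < N) sqnorm (z t j))); last first.
  by apply/funext => t; rewrite (L2sq_orthonormal mO L2phi orth) ?iota_uniq.
rewrite [X in _ --> X](_ : 0 = \sum_(0 <= j < N) 0); last by rewrite big1.
exact: cvg_sumr.
Qed.

(** Division by i lam_j gives the time derivative the coefficients c_j at time 0. *)
Definition lincomb_solution (c : nat -> R[i]) N t : E -> R[i] :=
  fun x => \sum_(0 <= j < N) (expi (lam j * t) * (c j / (0 +i* lam j))) * phi j x.

Definition lincomb_solution_deriv (c : nat -> R[i]) N t : E -> R[i] :=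
  fun x => \sum_(0 <= j < N) (expi (lam j * t) * c j) * phi j x.

Hypothesis lam_neq0 : forall j, lam j != 0.

Lemma schrodinger_solution_lincomb c N :
  schrodinger_solution Omega V (lincomb_solution c N 0)
    (lincomb_solution c N) (lincomb_solution_deriv c N).
Proof.
have il0 j : (0 +i* lam j : R[i]) != 0.
  by rewrite eq_complex /= negb_and lam_neq0 orbT.
split.
- by move=> t; exact: L2_lincomb.
- by move=> t; exact: L2_lincomb.
- move=> t; rewrite (_ : (fun h => _) = (fun h => sqL2norm Omega (fun x =>
      \sum_(0 <= j < N) (expi (lam j * t) * (c j / (0 +i* lam j)) *
        ((h^-1)%:C * (expi (lam j * h) - 1) - (0 +i* lam j))) * phi j x))); last first.
    apply/funext => h; congr sqL2norm; apply/funext => x.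
    rewrite /lincomb_solution /lincomb_solution_deriv -sumrB mulr_sumr -sumrB.
    by apply: eq_bigr => j _; rewrite (mulrDr (lam j)) expiD; move: (h^-1)%:C => r; field; exact: il0.
  by apply: lincomb_cvg0 => j; apply: cvanishZ; exact: expi_derivative.
- move=> t; rewrite (_ : (fun s => _) = (fun s => sqL2norm Omega (fun x =>
      \sum_(0 <= j < N) (c j * (expi (lam j * s) - expi (lam j * t))) * phi j x))); last first.
    apply/funext => s; congr sqL2norm; apply/funext => x.
    rewrite /lincomb_solution_deriv -sumrB.
    by apply: eq_bigr => j _; ring.
  by apply: lincomb_cvg0 => j; apply: cvanishZ; exact: continuous_expi.
- move=> t; apply: (proj1 (operator_domain_sum mO Omega_bounded _ _ _)) => j.
  exact: (eig j).1.
- move=> t; rewrite (_ : (fun x => (0 +i* 1) * _) = (fun x => \sum_(0 <= j < N)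
      (expi (lam j * t) * (c j / (0 +i* lam j))) * (- (lam j)%:C * phi j x))); last first.
    apply/funext => x; rewrite /lincomb_solution_deriv mulr_sumr; apply: eq_bigr => j _.
    have -> : - (lam j)%:C = (0 +i* lam j) * (0 +i* 1).
      by apply: complexP; rewrite !ReImE /=; ring.
    by field; exact: il0.
  apply: (schrodinger_eq_sum mO Omega_bounded V_Linfty _ _ L2phi) => j.
    exact: (L2Z mO (- (lam j)%:C) (L2phi j)).
  exact: (eig j).2.
- rewrite (_ : (fun x => _) = (fun=> 0)); last by apply/funext => x; rewrite subrr.
  by rewrite (sqL2normE mO (L2_0 mO)) /L2sq sqnorm0 Rintegral_cst// mul0r.
Qed.

Lemma observable_lincomb c N : 0 < energy (truncate N c) ->
  observable_solution Omega V (lincomb_solution c N) (lincomb_solution_deriv c N).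
Proof.
move=> c0; exists (lincomb_solution c N 0); split.
- by apply: (operator_domain_sum mO Omega_bounded) => j; exact: (eig j).1.
- exact: schrodinger_solution_lincomb.
- rewrite (sqL2normE mO (L2_lincomb _ _)) (L2sq_orthonormal mO L2phi orth) ?iota_uniq//.
  under eq_bigr do rewrite sqnormM sqnorm_expi mul1r.
  by rewrite -energy_truncate eqe gt_eqF.
Qed.

Lemma coef_lincomb_deriv c N : coef (lincomb_solution_deriv c N 0) = truncate N c.
Proof.
apply/funext => k; rewrite coef_lincomb /truncate; case: ifP => // _.
by rewrite mulr0 expi0 mul1r.
Qed.

(** The quotient of c is the limit of the quotients of its truncations, each of
    which is the limiting time average of an explicit solution; conversely every
    limiting time average is the quotient of some c. *)
Lemma observability_constantE : observability_constant Omega V omega =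
  ereal_inf [set spectral_quotient lam phi omega c | c in
    [set c | ell2 c /\ exists k, c k != 0]].
Proof.
apply/eqP; rewrite eq_le; apply/andP; split; apply: le_ereal_inf_tmp.
  move=> _ [c [c2 cn0] <-]; have c0 := energy_gt0 c2 cn0.
  have ecvg := energy_truncate_cvg c2.
  have near0 : \forall N \near \oo, 0 < energy (truncate N c) by exact: (cvgr_gt _ ecvg).
  rewrite (spectral_quotientE mO mo oO L2phi orth fin_eig c2 c0).
  have qcvg : (spectral omega lam phi (truncate N c) / energy (truncate N c))%:E
      @[N --> \oo] --> (spectral omega lam phi c / energy c)%:E.
    apply/fine_cvgP; split; first exact: nearW.
    apply: cvgM; first exact: (spectral_truncate_cvg mO mo oO L2phi orth fin_eig).
    by apply: cvgV => //; rewrite gt_eqF.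
  apply: (cvge_ge _ qcvg); apply: filterS near0 => N N0; apply: ereal_inf_lbound.
  exists (lincomb_solution c N), (lincomb_solution_deriv c N).
  have obs := observable_lincomb N0; split => //.
  have [_ _] := time_average_cvg obs; rewrite coef_lincomb_deriv.
  rewrite (spectral_quotientE mO mo oO L2phi orth fin_eig (ell2_truncate N c) N0) => avg.
  exact/esym/cvg_lim.
move=> _ [u [du [obs ->]]]; have [c2 cn0 avg] := time_average_cvg obs.
rewrite (cvg_lim _ avg)//; apply: ereal_inf_lbound.
by exists (coef (du 0)).
Qed.

End dirichlet_evolution.

Theorem theorem2p1 (R : realType) (d : nat) (Omega : set 'rV[R]_d.+1)
    (V : 'rV[R]_d.+1 -> R) (lam : nat -> R) (phi : nat -> 'rV[R]_d.+1 -> R[i])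
    (omega : set 'rV[R]_d.+1)
    (Omega_open : open Omega) (Omega_connected : connected Omega)
    (Omega_neq0 : Omega !=set0) (Omega_bounded : bounded_set Omega)
    (V_Linfty : Linfty Omega V)
    (basis : spectral_basis Omega V lam phi)
    (lam_neq0 : forall j, lam j != 0)
    (omega_measurable : measurable (omega : set (lebesgue_space R d)))
    (omega_sub : omega `<=` Omega) :
  (forall u du, observable_solution Omega V u du ->
     cvg (time_average Omega omega du T @[T --> +oo])) /\
  observability_constant Omega V omega =
  ereal_inf [set spectral_quotient lam phi omega c | c in
    [set c | ell2 c /\ exists k, c k != 0]].
Proof.
split; last first.
  exact: (observability_constantE Omega_open Omega_bounded V_Linfty basis).
move=> u du /(time_average_cvg Omega_open Omega_bounded V_Linfty basis
  omega_measurable omega_sub)[_ _ avg].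
by apply/cvg_ex; eexists; exact: avg.
Qed.
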